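(* Let $(V,A,B,C,\epsilon)$ be a quantum Airy structure. Then there exist unique $S_{h,n}$ ($h\ge0$, $n\ge1$), each $S_{h,n}$ a homogeneous polynomial of degree $n$ in finitely many of the variables $x^i$, such that $\psi=\exp\big(\sum_{h\ge0}\hbar^{h-1}\sum_{n\ge1}S_{h,n}\big)$ satisfies $\psi^{-1}\hat H_i(\psi)=0$ for all $i\in\mathbb{I}$ (as formal series in $\hbar$ and the $x^j$).
   Context: $V$ is a complex vector space with basis $\{e^i\}_{i\in\mathbb{I}}$, $\mathbb{I}$ finite or countable; $x^i$ are the corresponding coordinates and $\partial_i=\partial/\partial x^i$. Work in the Weyl algebra $\mathcal{D}^\hbar=\mathbb{C}[[x^i,\hbar\partial_i]][[\hbar]]$ with commutator $[\cdot,\cdot]$. A quantum pre-Airy structure consists of constants $a_{ijk},b_{ij}^k,c_i^{jk},\epsilon_i$ ($a$ and $c$ symmetric in the last two indices) with: only finitely many nonzero $a_{ijk}$ and $\epsilon_i$; for each $k$ only finitely many $(i,j)$ with $b_{ij}^k\ne0$; for each $(j,k)$ only finitely many $i$ with $c_i^{jk}\ne0$. Put $\hat H_i=-\hbar\partial_i+\sum_{j,k}a_{ijk}x^jx^k+2\hbar\sum_{j,k}b_{ij}^kx^j\partial_k+\hbar^2\sum_{j,k}c_i^{jk}\partial_j\partial_k+\hbar\epsilon_i$. It is a quantum Airy structure if $\frac1\hbar[\hat H_i,\hat H_j]=\sum_kg_{ij}^k\hat H_k$ for some constants $g_{ij}^k$. $\psi^{-1}\hat H_i(\psi)$ means applying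 the differential operator $\hat H_i$ to $\psi$ and dividing by $\psi$.
   Formalization: The formal statement requires S_{0,1}=S_{0,2}=0 (only 2h-2+n>0 contributes); without this uniqueness fails, e.g. in one variable H=-ħ∂+ħ²∂² annihilates both ψ=1 and ψ=exp(x/ħ). *)

(* Defs.v *)
From HB Require Import structures.
From mathcomp Require Import all_boot all_order all_algebra.
From mathcomp Require Import finmap multiset.
From mathcomp Require Import boolp classical_sets cardinality fsbigop reals.
From mathcomp Require Import complex.

Set Implicit Arguments.
Unset Strict Implicit.
Unset Printing Implicit Defensive.

Import Order.TTheory GRing.Theory Num.Theory.
Local Open Scope classical_set_scope.
Local Open Scope ring_scope.

(*  - The basis of V is indexed by a countable type I (finite or countable). *)
(*  - A monomial x^m (resp. (hbar d)^m) is a finite multiset m : {mset I};   *)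
(*    m i is the exponent of x^i.                                           *)
(*  - \sum_(t \in A) F t is the finitely supported sum of mathcomp-classical *)
(*    (all sums used below have finite support under the hypotheses).       *)

Section AiryDefs.
Variables (R : realType) (I : countType).
Local Notation C := (R[i]).
Local Notation mono := (multiset I).

Definition mdeg (m : mono) : nat := (\sum_(i <- finsupp m) m i)%N.
Definition mone (i : I) : mono := msetn 1 i.
Definition mzero : mono := @mset0 I.

(* An element is given by its normal-ordered coefficients:                  *)
(*   P = \sum_{p, al, be} P p al be * hbar^p x^al (hbar d)^be.               *)
Definition weyl := nat -> mono -> mono -> C.

Definition weyl_add (P Q : weyl) : weyl := fun p al be => P p al be + Q p al be.
Definition weyl_opp (P : weyl) : weyl := fun p al be => - P p al be.
Definition weyl_hbar (P : weyl) : weyl :=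
  fun p al be => if p is p'.+1 then P p' al be else 0.

Definition contr_weight (be1 al2 ka : mono) : C :=
  \prod_(i <- finsupp ka) (((ka i)`! * 'C(be1 i, ka i) * 'C(al2 i, ka i))%N)%:R.

(* product in the Weyl algebra, using
   (hbar d)^be1 x^al2 = \sum_ka hbar^|ka| ka! C(be1,ka) C(al2,ka) x^(al2-ka) (hbar d)^(be1-ka) *)
Definition weyl_mul (P Q : weyl) : weyl := fun p al be =>
  \sum_(t \in [set t : nat * nat * mono * mono * mono * mono * mono |
        let: (p1, p2, al1, al2, be1, be2, ka) := t in
        [/\ (p1 + p2 + mdeg ka)%N = p,
            msetD al1 al2 = msetD al ka &
            msetD be1 be2 = msetD be ka]])
    let: (p1, p2, al1, al2, be1, be2, ka) := t in
    P p1 al1 be1 * Q p2 al2 be2 * contr_weight be1 al2 ka.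

Definition weyl_comm (P Q : weyl) : weyl :=
  weyl_add (weyl_mul P Q) (weyl_opp (weyl_mul Q P)).

Definition weyl_lincomb (g : I -> C) (H : I -> weyl) : weyl :=
  fun p al be => \sum_(k \in [set: I]) g k * H k p al be.

(* H_i = -hbar d_i + \sum a_ijk x^j x^k + 2 hbar \sum b_ij^k x^j d_k
         + hbar^2 \sum c_i^jk d_j d_k + hbar eps_i                          *)
Definition Hop (a : I -> I -> I -> C) (b : I -> I -> I -> C)
    (c : I -> I -> I -> C) (eps : I -> C) (i : I) : weyl := fun p al be =>
  (if [&& p == 0%N, al == mzero & be == mone i] then -1 else 0)
  + (if (p == 0%N) && (be == mzero) then
       \sum_(jk \in [set jk : I * I | msetD (mone jk.1) (mone jk.2) = al])
          a i jk.1 jk.2 else 0)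
  + (if p == 0%N then
       \sum_(jk \in [set jk : I * I | mone jk.1 = al /\ mone jk.2 = be])
          2 * b i jk.1 jk.2 else 0)
  + (if (p == 0%N) && (al == mzero) then
       \sum_(jk \in [set jk : I * I | msetD (mone jk.1) (mone jk.2) = be])
          c i jk.1 jk.2 else 0)
  + (if [&& p == 1%N, al == mzero & be == mzero] then eps i else 0).

Definition quantum_pre_airy (a b c : I -> I -> I -> C) (eps : I -> C) : Prop :=
  [/\ (forall i j k, a i j k = a i k j) /\ (forall i j k, c i j k = c i k j),
      finite_set [set t : I * I * I | a t.1.1 t.1.2 t.2 != 0],
      finite_set [set l : I | eps l != 0],
      (forall k, finite_set [set ij : I * I | b ij.1 ij.2 k != 0]) &
      (forall j k, finite_set [set l : I | c l j k != 0])].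

(* quantum Airy structure: (1/hbar)[H_i, H_j] = \sum_k g_ij^k H_k,
   written as [H_i, H_j] = hbar * \sum_k g_ij^k H_k *)
Definition quantum_airy (a b c : I -> I -> I -> C) (eps : I -> C) : Prop :=
  quantum_pre_airy a b c eps /\
  exists g : I -> I -> I -> C, forall i j,
    weyl_comm (Hop a b c eps i) (Hop a b c eps j)
    = weyl_hbar (weyl_lincomb (g i j) (Hop a b c eps)).

(* f q m = coefficient of hbar^q x^m, q : int *)
Definition ser := int -> mono -> C.
Definition ser0 : ser := fun _ _ => 0.
Definition ser_opp (f : ser) : ser := fun q m => - f q m.
Definition ser_one : ser := fun q m => if (q == 0) && (m == mzero) then 1 else 0.

Definition ser_mul (f g : ser) : ser := fun q m =>
  \sum_(t \in [set t : int * int * mono * mono |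
         let: (q1, q2, m1, m2) := t in q1 + q2 = q /\ msetD m1 m2 = m])
    let: (q1, q2, m1, m2) := t in f q1 m1 * g q2 m2.

Fixpoint ser_pow (f : ser) (r : nat) : ser :=
  if r is r'.+1 then ser_mul f (ser_pow f r') else ser_one.

(* exp f = \sum_r f^r / r! (f without constant term in x) *)
Definition ser_exp (f : ser) : ser := fun q m =>
  \sum_(r \in [set: nat]) (r`!%:R)^-1 * ser_pow f r q m.

Definition mffact (m be : mono) : C :=
  \prod_(i <- finsupp be) ((m i) ^_ (be i))%:R.

(* action of a Weyl algebra element on a series:
   hbar^p x^al (hbar d)^be (hbar^q' x^m') = m'^{underline be} hbar^(p+q'+|be|) x^(al+m'-be) *)
Definition weyl_act (P : weyl) (f : ser) : ser := fun q m =>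
  \sum_(t \in [set t : nat * mono * mono * mono |
         let: (p, al, be, m') := t in msetD al m' = msetD m be])
    let: (p, al, be, m') := t in
    P p al be * mffact m' be * f (q - p%:Z - (mdeg be)%:Z) m'.

Definition poly_mono := mono -> C.
Definition homog_poly (n : nat) (P : poly_mono) : Prop :=
  finite_set [set m : mono | P m != 0] /\
  (forall m, P m != 0 -> mdeg m = n).

(* F = \sum_{h >= 0} hbar^(h-1) \sum_{n >= 1} S_{h,n} *)
Definition free_energy (S : nat -> nat -> poly_mono) : ser := fun q m =>
  match (q + 1)%R with
  | Posz h => \sum_(n \in [set n : nat | (0 < n)%N]) S h n m
  | Negz _ => 0
  end.

Definition wave (S : nat -> nat -> poly_mono) : ser := ser_exp (free_energy S).
Definition wave_inv (S : nat -> nat -> poly_mono) : ser :=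
  ser_exp (ser_opp (free_energy S)).

(* S solves the Airy constraints: each S_{h,n} (n >= 1) is a homogeneous
   polynomial of degree n, S_{0,1} = S_{0,2} = 0 (i.e. only 2h-2+n > 0
   contributes), and psi^{-1} H_i(psi) = 0 for all i. *)
Definition airy_solution (a b c : I -> I -> I -> C) (eps : I -> C)
    (S : nat -> nat -> poly_mono) : Prop :=
  [/\ (forall h n, (0 < n)%N -> homog_poly n (S h n)),
      S 0%N 1%N = (fun _ => 0),
      S 0%N 2%N = (fun _ => 0) &
      forall i, ser_mul (wave_inv S) (weyl_act (Hop a b c eps i) (wave S)) = ser0].

End AiryDefs.

(* Main.v *)
Require Import Defs.
From HB Require Import structures.
From mathcomp Require Import all_boot all_order all_algebra.
From mathcomp Require Import finmap multiset.
From mathcomp Require Import boolp classical_sets cardinality fsbigop reals.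
From mathcomp Require Import complex.
From mathcomp Require Import zify ring.

(* Give x weight 1 and hbar weight 2. Then H_i = - hbar d_i + Q_i with Q_i
   homogeneous of weight 2, so H_i psi = 0 reads hbar d_i psi_(N+1) = Q_i psi_N
   on weight components. If this holds up to weight N, the relation
   [H_i, H_j] = hbar sum_k g_ij^k H_k applied to psi_0 + ... + psi_N gives, in
   weight N + 3, that the family Q_i psi_N is closed, so psi_(N+1) exists; it is
   unique once its constant term is fixed. The finiteness conditions keep every
   psi_N a polynomial.

   In the variables hbar and y = x / hbar the wave function is an ordinary power
   series with constant term 1, so F = log psi makes sense. Dividing
   H_i psi = 0 by psi expresses hbar d_i F through Q_i and components of F of
   lower weight, whence hbar F has no negative power of hbar. Conversely F is
   recovered from psi by d_i psi = psi d_i F. *)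

Set Implicit Arguments.
Unset Strict Implicit.
Unset Printing Implicit Defensive.

Import Order.TTheory GRing.Theory Num.Theory.
Local Open Scope classical_set_scope.
Local Open Scope ring_scope.

(* The monomial hbar^(h-1) x^m with |m| = n has weight 2h - 2 + n, so S_{0,1} = S_{0,2} = 0 says
   that F has positive weight, that is, psi starts with 1 in weight 0. Why weight N + 3: H_k applied
   to psi_0 + ... + psi_N telescopes to Q_k psi_N, of weight N + 2. Hence the terms hbar g_ij^k H_k
   and Q_i Q_j contribute only in weight N + 4, and weight N + 3 retains the cross derivatives hbar
   d_i (Q_j psi_N) alone. The obstacle is convergence. For fixed i infinitely many b_ij^k and c_i^jk
   may be nonzero, and a finitely supported sum over an infinite support is 0 by convention, so
   interchanging sums requires a finite joint support. Laurent series in hbar do not multiply freely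
   either; passing to y turns hbar d/dx^i into d/dy^i and makes products, exp and log computable
   coefficient by coefficient. The exponent of hbar then becomes u = q + |m|, the weight becomes 2u
   - |m|, and a pole of order at most one in hbar reads |m| <= u + 1. *)
Local Infix ":+:" := msetD (at level 50, left associativity).
Local Infix ":-:" := msetB (at level 50, left associativity).

(** * Finitely supported sums: lists, Fubini, reindexing *)

Section FiniteSums.
Variable (C : idomainType).

Lemma fsum_seq (T : choiceType) (A : set T) (F : T -> C) (s : seq T) :
  uniq s -> (forall t, A t -> F t != 0 -> t \in s) ->
  \sum_(t \in A) F t = \sum_(t <- s | t \in A) F t.
Proof.
move=> us As; rewrite (bigfs _ (P := fun t => t \in A)) //; last first.
  by move=> t /set_mem At; apply: contraNeq; exact: As.
by apply: eq_fsbigl; apply/seteqP; split=> t /=; rewrite inE.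
Qed.

Lemma finite_enum (T : choiceType) (A : set T) : finite_set A ->
  exists2 s : seq T, uniq s & forall t, A t -> t \in s.
Proof.
move=> fA; exists (enum_fset (fset_set A)); first exact: fset_uniq.
by move=> t At; rewrite in_fset_set ?inE.
Qed.

Lemma finite_sigma (T U : Type) (A : set T) (B : T -> set U) :
  finite_set A -> (forall t, A t -> finite_set (B t)) ->
  finite_set [set x : T * U | A x.1 /\ B x.1 x.2].
Proof.
move=> fA fB.
apply: (@sub_finite_set _ _ (\bigcup_(t in A) (pair t @` B t))).
  by move=> [t u] /= [At Bu]; exists t => //; exists u.
by apply: bigcup_finite => // t At; apply: finite_image; exact: fB.
Qed.

(** Fubini. Finiteness is asked of the joint support only: the index sets are usually infinite, and
    an inner sum with infinite support would silently be 0. *)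
Lemma fsum_sigma (T U : choiceType) (A : set T) (B : T -> set U)
    (F : T -> U -> C) :
  finite_set [set x : T * U | [/\ A x.1, B x.1 x.2 & F x.1 x.2 != 0]] ->
  \sum_(t \in A) \sum_(u \in B t) F t u =
  \sum_(x \in [set x : T * U | A x.1 /\ B x.1 x.2]) F x.1 x.2.
Proof.
move=> fin; have [s us sP] := finite_enum fin.
have inE1 t u : A t -> B t u -> F t u != 0 -> t \in undup (unzip1 s).
  move=> At Bu Fu; rewrite mem_undup; apply/mapP; exists (t, u) => //.
  exact: sP.
have inE2 t u : A t -> B t u -> F t u != 0 -> u \in undup (unzip2 s).
  move=> At Bu Fu; rewrite mem_undup; apply/mapP; exists (t, u) => //.
  exact: sP.
have inner t : A t ->
    \sum_(u \in B t) F t u = \sum_(u <- undup (unzip2 s) | u \in B t) F t u.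
  move=> At; apply: fsum_seq; first exact: undup_uniq.
  by move=> u; exact: inE2.
rewrite (fsum_seq (undup_uniq (unzip1 s))); last first.
  move=> t At /fsbigN1 [u Bu Fu]; exact: (inE1 t u).
rewrite (fsum_seq
   (s := [seq (t, u) | t <- undup (unzip1 s), u <- undup (unzip2 s)])); first last.
- case=> t u /= [At Bu] Fu.
  by apply/allpairsP; exists (t, u) => /=; split=> //; [exact: (inE1 t u)|exact: (inE2 t u)].
- apply: allpairs_uniq; [exact: undup_uniq|exact: undup_uniq|].
  by move=> [? ?] [? ?] _ _ [-> ->].
rewrite big_mkcond [RHS]big_mkcond big_allpairs /=; apply: eq_bigr => t _.
rewrite -[RHS]big_mkcond /=.
case: ifP => [/set_mem At|/negP nA].
  by rewrite inner //; apply: eq_bigl => u; apply/idP/idP; rewrite !inE //= => -[].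
by rewrite big1 // => u; rewrite inE /= => -[At]; case: nA; rewrite inE.
Qed.

(** [h] and [k] need to be mutually inverse on the supports only. This allows reindexings written
    with truncated subtraction, which are wrong exactly where the summand vanishes. *)
Lemma fsum_bij (T U : choiceType) (A : set T) (B : set U) (F : T -> C)
    (G : U -> C) (h : T -> U) (k : U -> T) :
  (forall t, A t -> F t != 0 -> [/\ B (h t), k (h t) = t & G (h t) = F t]) ->
  (forall u, B u -> G u != 0 -> [/\ A (k u), h (k u) = u & F (k u) = G u]) ->
  \sum_(t \in A) F t = \sum_(u \in B) G u.
Proof.
move=> hP kP; rewrite [LHS]fsbig_supp [RHS]fsbig_supp.
rewrite (@reindex_fsbig _ _ _ _ _ h (A `&` F @^-1` [set~ 0])); last first.
  split=> /=.
  - move=> t [At /eqP Ft] /=; have [Bh _ ->] := hP _ At Ft; split=> //; exact/eqP.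
  - move=> t t' /set_mem [At /eqP Ft] /set_mem [At' /eqP Ft'] eqh.
    by have [_ <- _] := hP _ At Ft; have [_ <- _] := hP _ At' Ft'; rewrite eqh.
  - move=> u [Bu /eqP Gu]; have [Ak hk Fk] := kP _ Bu Gu; exists (k u) => //.
    by split=> //=; rewrite Fk; exact/eqP.
by apply: eq_fsbigr => t /set_mem [At /eqP Ft]; have [_ _ ->] := hP _ At Ft.
Qed.

Lemma fsumD (T : choiceType) (A : set T) (F G : T -> C) :
  finite_set [set t | A t /\ F t != 0] -> finite_set [set t | A t /\ G t != 0] ->
  \sum_(t \in A) (F t + G t) = \sum_(t \in A) F t + \sum_(t \in A) G t.
Proof.
move=> fF fG; have /finite_enum [s us sP] : finite_set
    ([set t | A t /\ F t != 0] `|` [set t | A t /\ G t != 0]).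
  by rewrite finite_setU.
rewrite !(fsum_seq us) ?big_split //.
- by move=> t At Gt; apply: sP; right.
- by move=> t At Ft; apply: sP; left.
- move=> t At FG; apply: sP; case: (eqVneq (F t) 0) => [F0|Ft]; last by left.
  by right; split=> //; move: FG; rewrite F0 add0r.
Qed.

Lemma fsum1 (T : choiceType) (A : set T) (F : T -> C) (t0 : T) : A t0 ->
  (forall t, A t -> F t != 0 -> t = t0) -> \sum_(t \in A) F t = F t0.
Proof.
move=> At0 H; rewrite (fsum_seq (s := [:: t0])) //; last first.
  by move=> t At Ft; rewrite (H t) // mem_seq1.
by rewrite big_cons big_nil; move/mem_set: At0 => ->; rewrite addr0.
Qed.

End FiniteSums.

(** * Multisets as monomials: degree, induction, submonomials *)

Section Multisets.
Variable (I : choiceType).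
Local Notation mono := (multiset I).
Implicit Types (m al be ka : mono).

Lemma msetDE m al i : (m :+: al) i = (m i + al i)%N.
Proof. by rewrite msetE2. Qed.

Lemma msetBE m al i : (m :-: al) i = (m i - al i)%N.
Proof. by rewrite msetE2. Qed.

End Multisets.

Ltac mset_lia :=
  repeat match goal with
  | H : _ = _ |- _ => move/msetP in H
  | H : is_true (msubset _ _) |- _ => move/msubsetP in H
  end;
  first [apply/msetP | apply/msubsetP];
  let i := fresh "i" in move=> i;
  repeat match goal with
  | H : @eqfun _ _ _ _ |- _ => move: {H} (H i)
  | H : forall x : _, is_true (leq _ _) |- _ => move: {H} (H i)
  end;
  rewrite ?(msetDE, msetBE, mset0E, msetnE) /=; lia.

Section Multisets.
Variable (I : countType).
Local Notation mono := (multiset I).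
Implicit Types (m al be ka : mono).

Lemma mdegE m (s : seq I) : uniq s -> {subset finsupp m <= s} ->
  mdeg m = (\sum_(i <- s) m i)%N.
Proof.
move=> us ms; rewrite /mdeg [RHS](bigID (mem (finsupp m))) /=.
rewrite [X in (_ + X)%N]big1; last by move=> i im; exact: fsfun_dflt.
rewrite addn0 -[RHS]big_filter; apply: perm_big; apply: uniq_perm.
- exact: fset_uniq.
- exact: filter_uniq.
by move=> i; rewrite mem_filter; case: (boolP (i \in finsupp m)) => // /ms ->.
Qed.

Lemma finsuppE m i : (i \in finsupp m) = (m i != 0%N).
Proof. by rewrite mem_finsupp. Qed.

Lemma mdegD m al : mdeg (m :+: al) = (mdeg m + mdeg al)%N.
Proof.
pose s := undup (finsupp m ++ finsupp al ++ finsupp (m :+: al))%SEQ.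
have us : uniq s := undup_uniq _.
rewrite !(@mdegE _ s) //; try by move=> i im; rewrite mem_undup !mem_cat im ?orbT.
by rewrite -big_split; apply: eq_bigr => i _; rewrite msetDE.
Qed.

Lemma mdeg_mone (i : I) : mdeg (mone i) = 1%N.
Proof.
rewrite (@mdegE _ [:: i]) //.
  by rewrite big_cons big_nil /mone msetnE eqxx.
by move=> j; rewrite finsuppE msetnE mem_seq1; case: (j == i).
Qed.

Lemma mdeg0 : mdeg (mzero I) = 0%N.
Proof. by rewrite (@mdegE _ [::]) ?big_nil // => i; rewrite finsuppE mset0E. Qed.

Lemma mdegB m al : msubset al m -> mdeg (m :-: al) = (mdeg m - mdeg al)%N.
Proof. by move=> /msetBDK {2}<-; rewrite mdegD addnK. Qed.

Lemma mono_split m : m = mzero I \/ exists i m', m = m' :+: mone i.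
Proof.
case: (eqVneq m (mzero I)) => [->|m0]; first by left.
right; have [i im] : exists i, m i != 0%N.
  apply: contrapT => /forallNP H; move/eqP: m0; apply; apply/msetP => i.
  by rewrite mset0E; apply/eqP; move: (H i) => /negP; rewrite negbK.
exists i, (m :-: mone i); apply/msetP => j; rewrite msetDE msetBE /mone msetnE.
by case: eqP => [->|]; lia.
Qed.

Lemma mono_split_i m i : (0 < m i)%N -> exists m', m = m' :+: mone i.
Proof.
move=> im; exists (m :-: mone i); apply/msetP => j; rewrite msetDE msetBE /mone msetnE.
by case: eqP => [->|]; lia.
Qed.

Lemma mdeg_eq0 m : mdeg m = 0%N -> m = mzero I.
Proof. by case: (mono_split m) => // -[i [m' ->]]; rewrite mdegD mdeg_mone addn1. Qed.

Lemma msub_deg m al : msubset al m -> (mdeg al <= mdeg m)%N.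
Proof. by move=> /msetBDK <-; rewrite mdegD leq_addl. Qed.

Lemma mono_ind (Pr : mono -> Prop) : Pr (mzero I) ->
  (forall i m, Pr m -> Pr (m :+: mone i)) -> forall m, Pr m.
Proof.
move=> P0 PS m; move: {2}(mdeg m) (erefl (mdeg m)) => n.
elim: n m => [|n IH] m; first by move/mdeg_eq0 ->.
case: (mono_split m) => [->|[i [m' ->]]]; first by rewrite mdeg0.
by rewrite mdegD mdeg_mone addn1 => -[/IH]; exact: PS.
Qed.

(** An explicit list, built variable by variable, so that a product of sums expands along the same
    recursion in [prod_sum_submonos]. *)
Definition submonos (b : I -> nat) (s : seq I) : seq mono :=
  foldr (fun i L => [seq msetn k i :+: ka | k <- iota 0 (b i).+1, ka <- L])
        [:: mzero I] s.

Lemma submonos_cons b i s : submonos b (i :: s) =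
  [seq msetn k i :+: ka | k <- iota 0 (b i).+1, ka <- submonos b s].
Proof. by []. Qed.

Lemma mem_submonos b s ka : uniq s ->
  reflect ((forall i, i \in s -> ka i <= b i)%N /\ (forall i, i \notin s -> ka i = 0%N))
          (ka \in submonos b s).
Proof.
elim: s ka => [|i s IH] ka.
  move=> _; rewrite mem_seq1; apply: (iffP eqP) => [->|[_ H]].
    by split=> // i _; rewrite mset0E.
  by apply/msetP => i; rewrite mset0E H.
rewrite submonos_cons cons_uniq => /andP[is_ us].
apply: (iffP allpairsP) => [[[k ka'] [kb /(IH _ us)[H1 H2] ->]]|].
  rewrite /= in H1 H2 *; split=> j; rewrite in_cons msetDE msetnE; case: eqP => [->|ne] /=.
  - by rewrite (H2 i) // addn0 => _; move: kb; rewrite mem_iota /=; lia.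
  - by move=> /H1.
  - by [].
  - by move=> /H2.
move=> [H1 H2]; exists (ka i, ka :-: msetn (ka i) i); split.
- by rewrite mem_iota leq0n add0n ltnS; apply: H1; rewrite mem_head.
- apply/(IH _ us); split=> j js; rewrite msetBE msetnE; case: eqP => [ji|ne].
  + by move: is_; rewrite -ji js.
  + by rewrite subn0 H1 // in_cons js orbT.
  + by rewrite ji subnn.
  + by rewrite subn0 H2 // in_cons negb_or js andbT; exact/eqP.
- apply/msetP => j; rewrite /= msetDE msetBE msetnE; case: eqP => [->|] /=; lia.
Qed.

Lemma submonos_uniq b s : uniq s -> uniq (submonos b s).
Proof.
elim: s => // i s IH; rewrite submonos_cons cons_uniq => /andP[is_ us].
apply: allpairs_uniq; [exact: iota_uniq|exact: IH|].
move=> [k ka] [k' ka'] /allpairsP [[? ?] [_ /(mem_submonos _ _ us)[_ H] [-> ->]]].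
move=> /allpairsP [[? ?] [_ /(mem_submonos _ _ us)[_ H'] [-> ->]]] E.
rewrite /= in H H' E *; move: (H _ is_) (H' _ is_) => Hi Hi'.
have Ek := congr1 (fun m : mono => m i) E; rewrite !msetDE !msetnE eqxx Hi Hi' !addn0 in Ek.
rewrite Ek; congr pair; apply/msetP => j.
by move/msetP/(_ j): E; rewrite Ek !msetDE => /addnI.
Qed.

Lemma submonosP m ka : (ka \in submonos m (finsupp m)) = msubset ka m.
Proof.
apply/(mem_submonos _ _ (fset_uniq _))/msubsetP => [[H1 H2] i|H].
  by case: (boolP (i \in finsupp m)) => [/H1 //|/H2 ->].
by split=> i // im; move: (H i); rewrite (fsfun_dflt im); lia.
Qed.

Lemma finite_submono m : finite_set [set ka : mono | msubset ka m].
Proof.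
apply: (@sub_finite_set _ _ [set` submonos m (finsupp m)]); last exact: finite_seq.
by move=> ka /=; rewrite submonosP.
Qed.

End Multisets.

(** * Vandermonde identities for falling factorials, in one and in several variables *)

Section Vandermonde.
Variables (C : comNzRingType) (I : countType).
Local Notation mono := (multiset I).

(** Since k! C(b,k) n^_(b-k) = b! C(n,b-k), this is b! times Vandermonde's convolution for
    C(n+a,b). *)
Lemma Vandermonde_ffact n a b :
  (\sum_(k < b.+1) k`! * 'C(b, k) * 'C(a, k) * n ^_ (b - k) = (n + a) ^_ b)%N.
Proof.
rewrite addnC -bin_ffact -binomial.Vandermonde big_distrl /=; apply: eq_bigr => k _.
rewrite -(bin_ffact n) -(@bin_fact b k); last by rewrite -ltnS.
ring.
Qed.

Lemma ffactD n a b : (n ^_ (a + b) = n ^_ a * (n - a) ^_ b)%N.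
Proof.
elim: a n => [|a IH] n; first by rewrite add0n ffactn0 mul1n subn0.
case: n => [|n]; first by rewrite addSn !(ffact_small (n := 0) (ltn0Sn _)).
by rewrite addSn !ffactSS IH mulnA subSS.
Qed.

Lemma prod_sum_submonos (b : I -> nat) (s : seq I) (F : I -> nat -> C) : uniq s ->
  \prod_(i <- s) \sum_(k < (b i).+1) F i k =
  \sum_(ka <- submonos b s) \prod_(i <- s) F i ((ka : mono) i).
Proof.
elim: s => [_|i s IH]; first by rewrite big_seq1 !big_nil.
rewrite submonos_cons cons_uniq => /andP[is_ us].
rewrite big_cons IH // big_allpairs_dep big_distrlr /=.
rewrite -(big_mkord xpredT (fun k => \sum_(ka <- submonos b s)
   F i k * \prod_(j <- s) F j ((ka : mono) j))) /index_iota subn0.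
apply: eq_bigr => k _; apply: eq_big_seq => ka /(mem_submonos _ _ us)[_ ka0].
rewrite big_cons msetDE msetnE eqxx ka0 // addn0; congr (_ * _).
apply: eq_big_seq => j js; rewrite msetDE msetnE.
by case: eqP => [ji|//]; move: is_; rewrite -ji js.
Qed.

End Vandermonde.

Section Weights.
Variables (R : realType) (I : countType).
Local Notation C := (R[i]).
Local Notation mono := (multiset I).
Implicit Types (m al be ka : mono).

Lemma mffactE m be (s : seq I) : uniq s -> {subset finsupp be <= s} ->
  mffact R m be = \prod_(i <- s) ((m i) ^_ (be i))%:R.
Proof.
move=> us bs; rewrite /mffact [RHS](bigID (mem (finsupp be))) /=.
rewrite [X in _ = _ * X]big1 ?mulr1; last first.
  by move=> i ib; rewrite (fsfun_dflt ib) ffactn0.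
rewrite -[RHS]big_filter; apply: perm_big; apply: uniq_perm.
- exact: fset_uniq.
- exact: filter_uniq.
by move=> i; rewrite mem_filter; case: (boolP (i \in finsupp be)) => // /bs ->.
Qed.

Lemma contr_weightE be al ka (s : seq I) : uniq s -> {subset finsupp ka <= s} ->
  contr_weight R be al ka =
  \prod_(i <- s) (((ka i)`! * 'C(be i, ka i) * 'C(al i, ka i))%N)%:R.
Proof.
move=> us bs; rewrite /contr_weight [RHS](bigID (mem (finsupp ka))) /=.
rewrite [X in _ = _ * X]big1 ?mulr1; last first.
  by move=> i ib; rewrite (fsfun_dflt ib) !bin0.
rewrite -[RHS]big_filter; apply: perm_big; apply: uniq_perm.
- exact: fset_uniq.
- exact: filter_uniq.
by move=> i; rewrite mem_filter; case: (boolP (i \in finsupp ka)) => // /bs ->.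
Qed.

Lemma mffact_neq0 m be : mffact R m be != 0 -> msubset be m.
Proof.
move=> H; apply/msubsetP => i.
case: (boolP (i \in finsupp be)) => ib; last by rewrite (fsfun_dflt ib).
rewrite leqNgt; apply/negP => lt; move: H; rewrite /mffact (big_rem i) //=.
by rewrite ffact_small // mul0r eqxx.
Qed.

Lemma contr_weight_neq0 be al ka : contr_weight R be al ka != 0 ->
  msubset ka be /\ msubset ka al.
Proof.
move=> H; split; apply/msubsetP => i; case: (boolP (i \in finsupp ka)) => ib;
  try (by rewrite (fsfun_dflt ib));
  rewrite leqNgt; apply/negP => lt; move: H; rewrite /contr_weight (big_rem i) //=;
  by rewrite (bin_small lt) muln0 ?mul0n mul0r eqxx.
Qed.

Lemma mffact0 m : mffact R m (mzero I) = 1.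
Proof. by rewrite (@mffactE _ _ [::]) ?big_nil // => i; rewrite finsuppE mset0E. Qed.

Lemma mffact_mone m i : mffact R m (mone i) = (m i)%:R.
Proof.
rewrite (@mffactE _ _ [:: i]) ?big_seq1 //; first by rewrite msetnE eqxx ffactn1.
by move=> j; rewrite finsuppE msetnE mem_seq1; case: (j == i).
Qed.

Lemma mffactD m al be :
  mffact R m (al :+: be) = mffact R m al * mffact R (m :-: al) be.
Proof.
pose s := undup (finsupp al ++ finsupp be ++ finsupp (al :+: be))%SEQ.
have us : uniq s := undup_uniq _.
rewrite !(@mffactE _ _ s) //; try by move=> i im; rewrite mem_undup !mem_cat im ?orbT.
by rewrite -big_split; apply: eq_bigr => i _; rewrite msetDE msetBE ffactD natrM.
Qed.

(** Two ways of applying d^be1 x^al2 d^be2 to x^m': on the left after normal ordering, summed over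
    the contractions [ka]; on the right in two successive steps. *)
Lemma Vandermonde_mono m' al2 be1 be2 : msubset be2 m' ->
  \sum_(ka \in [set ka | msubset ka be1])
    contr_weight R be1 al2 ka * mffact R m' (be1 :+: be2 :-: ka) =
  mffact R (al2 :+: m' :-: be2) be1 * mffact R m' be2.
Proof.
move=> sub; pose s := enum_fset (finsupp be1).
have us : uniq s := fset_uniq _.
rewrite (fsum_seq (submonos_uniq be1 us)); last first.
  by move=> ka /= kab _; rewrite submonosP.
rewrite big_seq_cond; under eq_bigl => ka.
  rewrite submonosP (_ : (ka \in [set ka | msubset ka be1]) = msubset ka be1); last first.
    by apply/idP/idP => [/set_mem //|H]; exact/mem_set.
  rewrite andbb -submonosP. over.
rewrite -big_seq [RHS]mulrC.
(* Differentiating by [be2] first extracts a common factor; the remaining sum factors over the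
   variables, with n = m' i - be2 i in each. *)
transitivity (mffact R m' be2 * \sum_(ka <- submonos be1 s)
    \prod_(i <- s) ((ka i)`! * 'C(be1 i, ka i) * 'C(al2 i, ka i)
                     * ((m' i - be2 i) ^_ (be1 i - ka i)))%:R : C).
  rewrite big_distrr /=; apply: eq_big_seq => ka; rewrite submonosP => kab.
  have -> : be1 :+: be2 :-: ka = be2 :+: (be1 :-: ka) by mset_lia.
  rewrite mffactD mulrCA; congr (_ * _).
  have sk : {subset finsupp ka <= s}.
    by move=> i; rewrite !finsuppE; move/msubsetP/(_ i): kab; lia.
  have sk' : {subset finsupp (be1 :-: ka) <= s}.
    by move=> i; rewrite !finsuppE msetBE; lia.
  rewrite (contr_weightE _ _ us sk) (mffactE _ us sk') -big_split /=.
  by apply: eq_bigr => i _; rewrite !msetBE -natrM.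
congr (_ * _); rewrite -(prod_sum_submonos be1 (fun i k => (k`! * 'C(be1 i, k) *
   'C(al2 i, k) * (m' i - be2 i) ^_ (be1 i - k))%:R : C)) //.
rewrite (@mffactE _ _ s) //; apply: eq_bigr => i _.
rewrite -natr_sum Vandermonde_ffact msetBE msetDE; congr (_ ^_ _)%:R.
by move/msubsetP/(_ i): sub; lia.
Qed.

End Weights.

(** * The action of the Weyl algebra on series is compatible with products *)

Section WeylAction.
Variables (R : realType) (I : countType).
Local Notation C := (R[i]).
Local Notation mono := (multiset I).
Implicit Types (m al be ka : mono) (P Q : weyl R I) (f : ser R I).

(** Columns are indexed by the derivative monomial. An operator with infinitely many terms still
    acts on a series if each column is finite and the order is bounded. *)
Definition weyl_colfin P :=
  forall be, finite_set [set pa : nat * mono | P pa.1 pa.2 be != 0].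

Definition weyl_order_le (B : nat) P :=
  forall p al be, P p al be != 0 -> (mdeg be <= B)%N.

(** Only the monomials are counted: in the action at a fixed (q, m), the power of hbar taken from
    the series is determined by the term of the operator, and it is at most q. *)
Definition ser_fin f := forall (D : nat) (q : int),
  finite_set [set m : mono | (mdeg m <= D)%N /\ exists2 q', q' <= q & f q' m != 0].

Definition act_dom m : set (nat * mono * mono * mono) :=
  [set t | let: (p, al, be, m') := t in al :+: m' = m :+: be].

Definition act_term P f (q : int) (t : nat * mono * mono * mono) : C :=
  let: (p, al, be, m') := t in
  P p al be * mffact R m' be * f (q - p%:Z - (mdeg be)%:Z) m'.

Lemma weyl_actE P f q m :
  weyl_act P f q m = \sum_(t \in act_dom m) act_term P f q t.
Proof. by []. Qed.

Lemma mulf3_neq0 (x y z : C) : x * y * z != 0 -> [/\ x != 0, y != 0 & z != 0].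
Proof. by rewrite !mulf_eq0 !negb_or => /andP[/andP[-> ->] ->]. Qed.

Lemma ser_fin_pairs f (D : nat) (q : int) : ser_fin f ->
  finite_set [set x : mono * mono |
    ((mdeg x.1 <= D)%N /\ exists2 q', q' <= q & f q' x.1 != 0) /\ msubset x.2 x.1].
Proof.
move=> ff; apply: (@finite_sigma _ _
   [set m | (mdeg m <= D)%N /\ exists2 q', q' <= q & f q' m != 0]
   (fun m => [set be | msubset be m])); first exact: ff.
by move=> m _; exact: finite_submono.
Qed.

Lemma act_dom_deg m al be m' : al :+: m' = m :+: be ->
  (mdeg al + mdeg m' = mdeg m + mdeg be)%N.
Proof. by move=> E; rewrite -!mdegD E. Qed.

(** The order bound gives |m'| <= |m| + B, so [ser_fin] leaves finitely many m', each with finitely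
    many be below it, and then the columns are finite. The index type [K] covers a single operator
    and a sum over all H_k at once. *)
Lemma finite_act_family (K : Type) (H : K -> weyl R I) B f q m :
  (forall be, finite_set [set x : K * (nat * mono) | H x.1 x.2.1 x.2.2 be != 0]) ->
  (forall k, weyl_order_le B (H k)) -> ser_fin f ->
  finite_set [set x : K * (nat * mono * mono * mono) |
     act_dom m x.2 /\ act_term (H x.1) f q x.2 != 0].
Proof.
move=> Hfin HB ff.
have fin := finite_sigma (B := fun mb : mono * mono =>
   [set x : K * (nat * mono) | H x.1 x.2.1 x.2.2 mb.2 != 0])
   (ser_fin_pairs (mdeg m + B)%N q ff) (fun mb _ => Hfin mb.2).
apply: sub_finite_set (finite_image
  (fun x : (mono * mono) * (K * (nat * mono)) =>
    (x.2.1, (x.2.2.1, x.2.2.2, x.1.2, x.1.1))) fin).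
move=> [k [[[p al] be] m']] /= [dm /mulf3_neq0 [Hn /mffact_neq0 sub fn]].
exists ((m', be), (k, (p, al))) => //=; split=> //; split=> //; split.
  have := act_dom_deg dm; have := HB _ _ _ _ Hn. lia.
by eexists; last exact: fn; lia.
Qed.

Lemma finite_act P B f q m : weyl_colfin P -> weyl_order_le B P -> ser_fin f ->
  finite_set [set t | act_dom m t /\ act_term P f q t != 0].
Proof.
move=> Pf PB ff.
have : finite_set [set x : unit * (nat * mono * mono * mono) |
     act_dom m x.2 /\ act_term P f q x.2 != 0].
  apply: (@finite_act_family unit (fun=> P) B) => // be.
  apply: sub_finite_set (finite_image (pair tt) (Pf be)).
  by case=> -[] pa /= Pn; exists pa.
by move/(finite_image snd); apply: sub_finite_set => t /= ?; exists (tt, t).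
Qed.

Lemma weyl_actD P Q S B f q m :
  weyl_colfin P -> weyl_order_le B P -> weyl_colfin Q -> weyl_order_le B Q ->
  ser_fin f -> (forall p al be, S p al be = P p al be + Q p al be) ->
  weyl_act S f q m = weyl_act P f q m + weyl_act Q f q m.
Proof.
move=> Pf PB Qf QB ff SE; rewrite !weyl_actE -fsumD; first last.
- exact: finite_act QB _.
- exact: finite_act PB _.
by apply: eq_fsbigr => -[[[p al] be] m'] _ /=; rewrite SE !mulrDl.
Qed.

Lemma weyl_act_ser_fin P B f : weyl_colfin P -> weyl_order_le B P ->
  ser_fin f -> ser_fin (weyl_act P f).
Proof.
move=> Pf PB ff D q.
have fin := finite_sigma (B := fun mb : mono * mono =>
   [set x : nat * mono | P x.1 x.2 mb.2 != 0])
   (ser_fin_pairs (D + B)%N q ff) (fun mb _ => Pf mb.2).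
apply: sub_finite_set (finite_image
  (fun x : (mono * mono) * (nat * mono) => x.2.2 :+: x.1.1 :-: x.1.2) fin).
move=> m /= [mD [q' qq']]; rewrite weyl_actE.
move=> /(@fsbigN1 _ _ _ unit _ _ (fun=> act_term P f q') tt).
move=> [[[[p al] be] m'] dm /mulf3_neq0 [Pn /mffact_neq0 sub fn]].
have := act_dom_deg dm; have := PB _ _ _ Pn => le1 le2.
exists ((m', be), (p, al)) => //=.
  split=> //; split=> //; split; first lia.
  by eexists; last exact: fn; lia.
by rewrite /= in dm; mset_lia.
Qed.

Definition comp_dom m : set ((nat * mono * mono * mono) * (nat * mono * mono * mono)) :=
  [set y | act_dom m y.1 /\ act_dom y.1.2 y.2].

Definition mul_dom (t : nat * mono * mono * mono) :
    set (nat * nat * mono * mono * mono * mono * mono) :=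
  let: (p, al, be, _) := t in
  [set s | let: (p1, p2, al1, al2, be1, be2, ka) := s in
        [/\ (p1 + p2 + mdeg ka)%N = p, al1 :+: al2 = al :+: ka & be1 :+: be2 = be :+: ka]].

Definition mul_term P Q (s : nat * nat * mono * mono * mono * mono * mono) : C :=
  let: (p1, p2, al1, al2, be1, be2, ka) := s in
  P p1 al1 be1 * Q p2 al2 be2 * contr_weight R be1 al2 ka.

Lemma finite_comp P Q B f q m :
  weyl_colfin P -> weyl_order_le B P -> weyl_colfin Q -> weyl_order_le B Q -> ser_fin f ->
  finite_set [set y | comp_dom m y /\
    let: (p1, al1, be1, m1, (p2, al2, be2, m')) := y in
    [/\ P p1 al1 be1 != 0, Q p2 al2 be2 != 0, msubset be1 m1, msubset be2 m' &
      exists2 q', q' <= q & f q' m' != 0]].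
Proof.
move=> Pf PB Qf QB ff.
have fin1 := finite_sigma (B := fun mb : mono * mono =>
   [set x : nat * mono | Q x.1 x.2 mb.2 != 0])
   (ser_fin_pairs (mdeg m + B + B)%N q ff) (fun mb _ => Qf mb.2).
have fin2 := finite_sigma (B := fun x : (mono * mono) * (nat * mono) =>
   [set be | msubset be (x.2.2 :+: x.1.1 :-: x.1.2)]) fin1
   (fun x _ => finite_submono _).
have fin3 := finite_sigma (B := fun x : (mono * mono) * (nat * mono) * mono =>
   [set x' : nat * mono | P x'.1 x'.2 x.2 != 0]) fin2 (fun x _ => Pf x.2).
apply: sub_finite_set (finite_image (fun x =>
   let: ((m', be2), (p2, al2), be1, (p1, al1)) := x in
   (p1, al1, be1, al2 :+: m' :-: be2, (p2, al2, be2, m'))) fin3).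
case=> -[[[p1 al1] be1] m1] [[[p2 al2] be2] m'] /= [[/= d1 d2] [Pn Qn s1 s2 fn]].
have m1E : m1 = al2 :+: m' :-: be2 by clear -d2; mset_lia.
exists ((m', be2), (p2, al2), be1, (p1, al1)); last by rewrite m1E.
rewrite /= -m1E; split=> //; split=> //; split=> //; split=> //; split=> //.
have := PB _ _ _ Pn; have := QB _ _ _ Qn.
have := congr1 (@mdeg I) d1; have := congr1 (@mdeg I) d2; rewrite !mdegD; lia.
Qed.

(** A term of the normal-ordered product acting on x^m' corresponds to a path from m' through m1 to
    m, one step for each operator, together with the contraction [ka]. The intermediate monomial is
    m1 = al2 + m' - be2. *)
Definition to_comp (x : (nat * mono * mono * mono) *
    (nat * nat * mono * mono * mono * mono * mono)) :=
  let: (p, al, be, m', (p1, p2, al1, al2, be1, be2, ka)) := x in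
  (p1, al1, be1, al2 :+: m' :-: be2, (p2, al2, be2, m'), ka).

Definition of_comp (x : (nat * mono * mono * mono) * (nat * mono * mono * mono) * mono) :=
  let: (p1, al1, be1, m1, (p2, al2, be2, m'), ka) := x in
  (((p1 + p2 + mdeg ka)%N, al1 :+: al2 :-: ka, be1 :+: be2 :-: ka, m'),
   (p1, p2, al1, al2, be1, be2, ka)).

Definition comp_term P Q f q
    (x : (nat * mono * mono * mono) * (nat * mono * mono * mono) * mono) : C :=
  let: (p1, al1, be1, m1, (p2, al2, be2, m'), ka) := x in
  P p1 al1 be1 * Q p2 al2 be2 *
  f (q - p1%:Z - (mdeg be1)%:Z - p2%:Z - (mdeg be2)%:Z) m' *
  (contr_weight R be1 al2 ka * mffact R m' (be1 :+: be2 :-: ka)).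

(** The inclusion of [be2] in m' makes the truncated subtraction in [to_comp] exact. *)
Definition comp_dom' m : set ((nat * mono * mono * mono) * (nat * mono * mono * mono)) :=
  [set y | comp_dom m y /\ msubset y.2.1.2 y.2.2].

Lemma to_compP P Q f q m x :
  act_dom m x.1 -> mul_dom x.1 x.2 ->
  mul_term P Q x.2 * mffact R x.1.2 x.1.1.2 *
     f (q - x.1.1.1.1%:Z - (mdeg x.1.1.2)%:Z) x.1.2 != 0 ->
  [/\ comp_dom' m (to_comp x).1 /\ msubset (to_comp x).2 (to_comp x).1.1.1.2,
      of_comp (to_comp x) = x &
      comp_term P Q f q (to_comp x) =
      mul_term P Q x.2 * mffact R x.1.2 x.1.1.2 *
        f (q - x.1.1.1.1%:Z - (mdeg x.1.1.2)%:Z) x.1.2].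
Proof.
case: x => -[[[p al] be] m'] [[[[[[p1 p2] al1] al2] be1] be2] ka] /= d [E1 E2 E3].
move=> /mulf3_neq0 [/mulf3_neq0[Pn Qn /contr_weight_neq0[s1 s2]] /mffact_neq0 s3 fn].
have alE : al1 :+: al2 :-: ka = al by clear -E2; mset_lia.
have beE : be1 :+: be2 :-: ka = be by clear -E3; mset_lia.
have s4 : msubset be2 m' by clear -s1 s3 E3; mset_lia.
split.
- split=> //; split=> //; split=> /=; first by clear -d E2 E3 s4; mset_lia.
  by clear -s4; mset_lia.
- by rewrite E1 alE beE.
rewrite beE (_ : q - p1%:Z - _ - _ - _ = q - p%:Z - (mdeg be)%:Z); first ring.
by have := congr1 (@mdeg I) E3; rewrite !mdegD -E1; lia.
Qed.

Lemma of_compP P Q f q m y :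
  comp_dom' m y.1 -> msubset y.2 y.1.1.1.2 -> comp_term P Q f q y != 0 ->
  [/\ act_dom m (of_comp y).1 /\ mul_dom (of_comp y).1 (of_comp y).2,
      to_comp (of_comp y) = y &
      mul_term P Q (of_comp y).2 * mffact R (of_comp y).1.2 (of_comp y).1.1.2 *
        f (q - (of_comp y).1.1.1.1%:Z - (mdeg (of_comp y).1.1.2)%:Z) (of_comp y).1.2
      = comp_term P Q f q y].
Proof.
case: y => -[[[[p1 al1] be1] m1] [[[p2 al2] be2] m']] ka /= [[/= d1 d2] s2] sk.
move=> /mulf3_neq0 [_ fn]; rewrite mulf_eq0 negb_or => /andP[/contr_weight_neq0[_ s1]].
move=> /mffact_neq0 s3; split.
- split; first by clear -d1 d2 s2 sk s1; mset_lia.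
  by split=> //; clear -s1 sk; mset_lia.
- by do !congr pair; clear -d2 s2; mset_lia.
rewrite (_ : q - p1%:Z - _ - _ - _ =
   q - (p1 + p2 + mdeg ka)%N%:Z - (mdeg (be1 :+: be2 :-: ka))%:Z); first ring.
have : (mdeg (be1 :+: be2 :-: ka) + mdeg ka = mdeg be1 + mdeg be2)%N.
  by rewrite -!mdegD; congr mdeg; clear -sk; mset_lia.
lia.
Qed.

Lemma finite_mul_act P Q B f q m :
  weyl_colfin P -> weyl_order_le B P -> weyl_colfin Q -> weyl_order_le B Q -> ser_fin f ->
  finite_set [set x : (nat * mono * mono * mono) *
     (nat * nat * mono * mono * mono * mono * mono) |
     [/\ act_dom m x.1, mul_dom x.1 x.2 &
     mul_term P Q x.2 * mffact R x.1.2 x.1.1.2 *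
     f (q - x.1.1.1.1%:Z - (mdeg x.1.1.2)%:Z) x.1.2 != 0]].
Proof.
move=> Pf PB Qf QB ff.
have fin := finite_sigma (B := fun y : (nat * mono * mono * mono) *
   (nat * mono * mono * mono) => [set ka | msubset ka y.1.1.2])
   (finite_comp q m Pf PB Qf QB ff) (fun y _ => finite_submono _).
apply: sub_finite_set (finite_image of_comp fin) => x [d1 d2 n].
have [[[d3 s1] s2] xE n'] := to_compP d1 d2 n; exists (to_comp x) => //.
split=> //; split=> //; rewrite -n' in n; move: n d3 s1 s2.
case: (to_comp x) => -[[[[p1 al1] be1] m1] [[[p2 al2] be2] m']] ka /=.
rewrite !mulf_eq0 !negb_or => /andP[/andP[/andP[-> ->] fn]].
move=> /andP[/contr_weight_neq0[_ s1] /mffact_neq0 s3] [_ /= d] s2 sk.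
split=> //; last by eexists; last exact: fn; lia.
by clear -s1 s3 d s2 sk; mset_lia.
Qed.

Lemma weyl_act_mul P Q B f q m :
  weyl_colfin P -> weyl_order_le B P -> weyl_colfin Q -> weyl_order_le B Q -> ser_fin f ->
  weyl_act (weyl_mul P Q) f q m = weyl_act P (weyl_act Q f) q m.
Proof.
move=> Pf PB Qf QB ff.
pose LT (t : nat * mono * mono * mono) s := mul_term P Q s * mffact R t.2 t.1.2 *
     f (q - t.1.1.1%:Z - (mdeg t.1.2)%:Z) t.2.
transitivity (\sum_(t \in act_dom m) \sum_(s \in mul_dom t) LT t s).
  rewrite weyl_actE; apply: eq_fsbigr => -[[[p al] be] m'] _.
  by rewrite /act_term /weyl_mul !mulr_fsuml; apply: eq_fsbigr => -[[[[[[? ?] ?] ?] ?] ?] ?].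
rewrite fsum_sigma; last exact: finite_mul_act Pf PB Qf QB ff.
transitivity (\sum_(y \in [set y | comp_dom' m y.1 /\ msubset y.2 y.1.1.1.2])
   comp_term P Q f q y).
  apply: (fsum_bij (h := to_comp) (k := of_comp)).
    by move=> x [d1 d2] n; exact: to_compP.
  by move=> y [d1 d2] n; exact: of_compP.
have fin := finite_comp q m Pf PB Qf QB ff.
transitivity (\sum_(y \in comp_dom' m)
    \sum_(ka \in [set ka | msubset ka y.1.1.2]) comp_term P Q f q (y, ka)).
  rewrite (@fsum_sigma _ _ _ _ _ (fun y ka => comp_term P Q f q (y, ka))).
    by apply: eq_fsbigr => -[y ka].
  have := finite_sigma (B := fun y : (nat * mono * mono * mono) *
     (nat * mono * mono * mono) => [set ka | msubset ka y.1.1.2]) fin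
     (fun y _ => finite_submono _).
  apply: sub_finite_set => -[y ka] [[d s] sk n]; split=> //; split=> //.
  move: n d s sk; case: y => -[[[p1 al1] be1] m1] [[[p2 al2] be2] m'] /=.
  rewrite !mulf_eq0 !negb_or => /andP[/andP[/andP[-> ->] fn]].
  move=> /andP[/contr_weight_neq0[_ s1] /mffact_neq0 s3] [_ /= d] s2 sk.
  split=> //; last by eexists; last exact: fn; lia.
  by clear -s1 s3 d s2 sk; mset_lia.
pose RT (y : (nat * mono * mono * mono) * (nat * mono * mono * mono)) : C :=
  let: (p1, al1, be1, m1, t) := y in
  P p1 al1 be1 * mffact R m1 be1 * act_term Q f (q - p1%:Z - (mdeg be1)%:Z) t.
(* For a fixed path, the sum over all contractions is [Vandermonde_mono]. *)
transitivity (\sum_(y \in comp_dom' m) RT y).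
  apply: eq_fsbigr => -[[[[p1 al1] be1] m1] [[[p2 al2] be2] m']] /set_mem[[/= d1 d2] s].
  rewrite -mulr_fsumr Vandermonde_mono //.
  by rewrite (_ : al2 :+: m' :-: be2 = m1); [ring|clear -d2; mset_lia].
(* A path with [be2] not below m' carries the factor [mffact R m' be2] = 0, so the restriction can
   be lifted. *)
transitivity (\sum_(y \in comp_dom m) RT y).
  apply: fsbig_widen; first by move=> y [].
  move=> -[[[[p1 al1] be1] m1] [[[p2 al2] be2] m']] [d nd] /=.
  apply/eqP; apply: contrapT => /negP; rewrite !mulf_eq0 !negb_or.
  move=> /andP[_ /andP[/andP[_ /mffact_neq0 s] _]]; by case: nd.
transitivity (\sum_(t \in act_dom m) \sum_(t' \in act_dom t.2) RT (t, t')).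
  rewrite (@fsum_sigma _ _ _ _ _ (fun t t' => RT (t, t'))).
    by apply: eq_fsbigr => -[y ka].
  apply: sub_finite_set fin => -[[[[p1 al1] be1] m1] [[[p2 al2] be2] m']] [d1 d2].
  rewrite /RT /= !mulf_eq0 !negb_or.
  move=> /andP[/andP[Pn /mffact_neq0 s1] /andP[/andP[Qn /mffact_neq0 s2] fn]].
  by split=> //; split=> //; eexists; last exact: fn; lia.
rewrite weyl_actE; apply: eq_fsbigr => -[[[p1 al1] be1] m1] _.
by rewrite /act_term weyl_actE mulr_fsumr.
Qed.

Lemma weyl_act_comm P Q L B f q m :
  weyl_colfin P -> weyl_order_le B P -> weyl_colfin Q -> weyl_order_le B Q -> ser_fin f ->
  weyl_comm P Q = L ->
  weyl_act L f q m =
  weyl_act P (weyl_act Q f) q m - weyl_act Q (weyl_act P f) q m.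
Proof.
move=> Pf PB Qf QB ff <-; rewrite -!(@weyl_act_mul _ _ B) //.
have fin P' Q' : weyl_colfin P' -> weyl_order_le B P' -> weyl_colfin Q' ->
    weyl_order_le B Q' ->
    finite_set [set t | act_dom m t /\ act_term (weyl_mul P' Q') f q t != 0].
  move=> Pf' PB' Qf' QB'.
  have := finite_image fst (finite_mul_act q m Pf' PB' Qf' QB' ff).
  apply: sub_finite_set => -[[[p al] be] m'] [d] /mulf3_neq0 [].
  rewrite /weyl_mul => /(@fsbigN1 _ _ _ unit _ _ (fun=> mul_term P' Q') tt)[s ds ns] n2 n3.
  by exists ((p, al, be, m'), s) => //; split=> //=; rewrite !mulf_neq0.
rewrite !weyl_actE -[X in _ = _ + X]mulN1r mulr_fsumr -fsumD.
- apply: eq_fsbigr => -[[[p al] be] m'] _ /=.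
  by rewrite /weyl_comm /weyl_add /weyl_opp mulN1r !mulrDl !mulNr.
- exact: fin.
- apply: sub_finite_set (fin Q P Qf QB Pf PB) => t [d n]; split=> //.
  by apply: contraNneq n => ->; rewrite mulr0.
Qed.

Lemma weyl_act_hbar P f q m : weyl_act (weyl_hbar P) f q m = weyl_act P f (q - 1) m.
Proof.
rewrite !weyl_actE.
apply: (fsum_bij (h := fun t => (t.1.1.1.-1, t.1.1.2, t.1.2, t.2))
                 (k := fun t => (t.1.1.1.+1, t.1.1.2, t.1.2, t.2))).
  move=> [[[[|p] al] be] m'] d; first by rewrite /= !mul0r eqxx.
  by move=> _; split=> //=; congr (_ * f _ _); lia.
by move=> [[[p al] be] m'] d _; split=> //=; congr (_ * f _ _); lia.
Qed.

(** The constants [g] may be nonzero for infinitely many k. The interchange holds because in each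
    column only finitely many pairs of an index k and a term of H_k occur. *)
Lemma weyl_act_lincomb (g : I -> C) (H : I -> weyl R I) B f q m :
  (forall be, finite_set [set x : I * (nat * mono) | H x.1 x.2.1 x.2.2 be != 0]) ->
  (forall k, weyl_order_le B (H k)) -> ser_fin f ->
  weyl_act (weyl_lincomb g H) f q m = \sum_(k \in [set: I]) g k * weyl_act (H k) f q m.
Proof.
move=> Hf HB ff; have fin := finite_act_family q m Hf HB ff.
transitivity (\sum_(t \in act_dom m) \sum_(k \in [set: I]) g k * act_term (H k) f q t).
  rewrite weyl_actE; apply: eq_fsbigr => -[[[p al] be] m'] _.
  rewrite /act_term /weyl_lincomb !mulr_fsuml; apply: eq_fsbigr => k _; ring.
transitivity (\sum_(k \in [set: I]) \sum_(t \in act_dom m) g k * act_term (H k) f q t).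
  rewrite !fsum_sigma.
  - apply: (fsum_bij (h := fun x => (x.2, x.1)) (k := fun x => (x.2, x.1))).
      by move=> [t k] /= [d _] _.
    by move=> [t k] /= [_ d] _.
  - apply: sub_finite_set fin => -[k t] /= [_ d n]; split=> //.
    by apply: contraNneq n => ->; rewrite mulr0.
  - apply: sub_finite_set (finite_image (fun x => (x.2, x.1)) fin).
    move=> [t k] /= [d _ n]; exists (k, t) => //; split=> //=.
    by apply: contraNneq n => ->; rewrite mulr0.
by apply: eq_fsbigr => k _; rewrite weyl_actE mulr_fsumr.
Qed.

End WeylAction.

(** * The Hamiltonians as - hbar d_i plus a part homogeneous of weight 2 *)

Section HamiltonianSplit.
Variables (R : realType) (I : countType).
Local Notation C := (R[i]).
Local Notation mono := (multiset I).
Implicit Types (m al be ka : mono) (f : ser R I).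

Definition Dop (i : I) : weyl R I := fun p al be =>
  if [&& p == 0%N, al == mzero I & be == mone i] then -1 else 0.

Definition Hadd (Q : I -> weyl R I) (i : I) : weyl R I :=
  fun p al be => Dop i p al be + Q i p al be.

(* In the grading with x of weight 1 and hbar of weight 2, all terms of the
   Hamiltonians other than - hbar d_i are homogeneous of weight 2. *)
Definition Qweight2 (Q : I -> weyl R I) := forall i p al be,
  Q i p al be != 0 -> (p.*2 + mdeg al + mdeg be = 2)%N.

Definition family_colfin (H : I -> weyl R I) := forall be,
  finite_set [set x : I * (nat * mono) | H x.1 x.2.1 x.2.2 be != 0].

Definition Qop (a b c : I -> I -> I -> C) (eps : I -> C) (i : I) : weyl R I :=
  fun p al be =>
  (if (p == 0%N) && (be == mzero I) then
       \sum_(jk \in [set jk : I * I | mone jk.1 :+: mone jk.2 = al])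
          a i jk.1 jk.2 else 0)
  + (if p == 0%N then
       \sum_(jk \in [set jk : I * I | mone jk.1 = al /\ mone jk.2 = be])
          2 * b i jk.1 jk.2 else 0)
  + (if (p == 0%N) && (al == mzero I) then
       \sum_(jk \in [set jk : I * I | mone jk.1 :+: mone jk.2 = be])
          c i jk.1 jk.2 else 0)
  + (if [&& p == 1%N, al == mzero I & be == mzero I] then eps i else 0).

Lemma Hop_split a b c eps : Hop a b c eps = Hadd (Qop a b c eps).
Proof.
apply/funext => i; apply/funext => p; apply/funext => al; apply/funext => be.
by rewrite /Hop /Hadd /Dop /Qop !addrA.
Qed.

Lemma addr_neq0 (x y : C) : x + y != 0 -> x != 0 \/ y != 0.
Proof. by case: (eqVneq x 0) => [->|]; [rewrite add0r; right|left]. Qed.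

Lemma if_neq0 (e : bool) (x : C) : (if e then x else 0) != 0 -> e /\ x != 0.
Proof. by case: e => //; rewrite eqxx. Qed.

Lemma fsum_neq0 (T : choiceType) (A : set T) (F : T -> C) :
  \sum_(t \in A) F t != 0 -> exists2 t, A t & F t != 0.
Proof. exact: (@fsbigN1 _ _ _ unit _ _ (fun=> F) tt). Qed.

Lemma Qop_neq0 a b c eps i p al be : Qop a b c eps i p al be != 0 ->
  [\/ [/\ p = 0%N, be = mzero I &
          exists j k, mone j :+: mone k = al /\ a i j k != 0],
      [/\ p = 0%N & exists j k, [/\ mone j = al, mone k = be & b i j k != 0]],
      [/\ p = 0%N, al = mzero I &
          exists j k, mone j :+: mone k = be /\ c i j k != 0] |
      [/\ p = 1%N, al = mzero I, be = mzero I & eps i != 0]].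
Proof.
move=> /addr_neq0 [/addr_neq0 [/addr_neq0 []|]|] /if_neq0 [].
- move=> /andP[/eqP -> /eqP ->] /fsum_neq0 [[j k] /= E n].
  by apply: Or41; split=> //; exists j, k.
- move=> /eqP -> /fsum_neq0 [[j k] /= [E1 E2]]; rewrite mulf_eq0 negb_or => /andP[_ n].
  by apply: Or42; split=> //; exists j, k.
- move=> /andP[/eqP -> /eqP ->] /fsum_neq0 [[j k] /= E n].
  by apply: Or43; split=> //; exists j, k.
- by move=> /and3P[/eqP -> /eqP -> /eqP ->] n; apply: Or44.
Qed.

Lemma Qop_weight2 a b c eps : Qweight2 (Qop a b c eps).
Proof.
move=> i p al be /Qop_neq0 [].
- by move=> [-> -> [j [k [<- _]]]]; rewrite mdegD !mdeg_mone mdeg0.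
- by move=> [-> [j [k [<- <- _]]]]; rewrite !mdeg_mone.
- by move=> [-> -> [j [k [<- _]]]]; rewrite mdegD !mdeg_mone mdeg0.
- by move=> [-> -> -> _]; rewrite mdeg0.
Qed.

Lemma mone_inj : injective (@mone I).
Proof.
move=> i j /msetP/(_ i); rewrite /mone !msetnE eqxx.
by case: eqP.
Qed.

Lemma finite_mone2 be : finite_set [set jk : I * I | mone jk.1 :+: mone jk.2 = be].
Proof.
apply: (@sub_finite_set _ _ ([set` finsupp be] `*` [set` finsupp be])).
  move=> [j k] /= <-; rewrite !finsuppE !msetDE /mone !msetnE !eqxx; split=> /=; lia.
by apply: finite_setX; exact: finite_fset.
Qed.

(** The four finiteness conditions match the four kinds of terms: those from a and eps are finitely
    many in all; in a b-term be = e_k fixes k; in a c-term be = e_j + e_k leaves finitely many (j,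
    k). *)
Lemma Qop_family_colfin a b c eps : quantum_pre_airy a b c eps ->
  family_colfin (Qop a b c eps).
Proof.
move=> [_ fa fe fb fc] be.
pose A1 := (fun t : I * I * I => (t.1.1, (0%N, mone t.1.2 :+: mone t.2)))
   @` [set t : I * I * I | a t.1.1 t.1.2 t.2 != 0].
pose A2 := \bigcup_(k in [set k | mone k = be])
   ((fun ij : I * I => (ij.1, (0%N, mone ij.2))) @` [set ij | b ij.1 ij.2 k != 0]).
pose A3 := \bigcup_(jk in [set jk : I * I | mone jk.1 :+: mone jk.2 = be])
   ((fun l : I => (l, (0%N, mzero I))) @` [set l | c l jk.1 jk.2 != 0]).
pose A4 := (fun l : I => (l, (1%N, mzero I))) @` [set l | eps l != 0].
apply: (@sub_finite_set _ _ (A1 `|` A2 `|` A3 `|` A4)).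
  move=> [i [p al]] /= /Qop_neq0 [].
  - move=> [-> _ [j [k [<- n]]]]; left; left; left; by exists (i, j, k).
  - move=> [-> [j [k [<- E n]]]]; left; left; right; exists k => //; by exists (i, j).
  - move=> [-> -> [j [k [E n]]]]; left; right; exists (j, k) => //; by exists i.
  - by move=> [-> -> _ n]; right; exists i.
rewrite !finite_setU; split; last exact: finite_image.
split; last first.
  apply: bigcup_finite; first exact: finite_mone2.
  by move=> jk _; exact: finite_image.
split; first exact: finite_image.
apply: bigcup_finite; last by move=> k _; exact: finite_image.
case: (pselect (exists k, mone k = be)) => [[k <-]|nk].
  by apply: sub_finite_set (finite_set1 k) => l /= /mone_inj.
by apply: sub_finite_set (@finite_set0 I) => l /= E; apply: nk; exists l.
Qed.

Lemma Dop_neq0 i p al be : Dop i p al be != 0 ->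
  [/\ p = 0%N, al = mzero I & be = mone i].
Proof. by rewrite /Dop => /if_neq0 [/and3P[/eqP -> /eqP -> /eqP ->] _]. Qed.

Lemma Dop_colfin i : weyl_colfin (Dop i).
Proof.
move=> be; apply: sub_finite_set (finite_set1 (0%N, mzero I)).
by move=> [p al] /= /Dop_neq0 [-> -> _].
Qed.

Lemma Dop_order i : weyl_order_le 2 (Dop i).
Proof. by move=> p al be /Dop_neq0 [_ _ ->]; rewrite mdeg_mone. Qed.

Lemma weyl_act_Dop i f q m :
  weyl_act (Dop i) f q m = - ((m i).+1%:R * f (q - 1) (m :+: mone i)).
Proof.
rewrite weyl_actE (fsum1 (t0 := (0%N, mzero I, mone i, m :+: mone i))).
- rewrite /act_term /Dop !eqxx /= mffact_mone mdeg_mone msetDE msetnE eqxx addn1 subr0.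
  by rewrite mulN1r mulNr.
- by rewrite /act_dom /= /mzero mset0D.
- move=> [[[p al] be] m'] /= d /mulf3_neq0 [/Dop_neq0 [E1 E2 E3] _ _].
  by move: d; rewrite E1 E2 E3 /mzero mset0D => ->.
Qed.

Section FamilyQ.
Variable Q : I -> weyl R I.
Hypotheses (Qw : Qweight2 Q) (Qf : family_colfin Q).

Lemma Q_colfin i : weyl_colfin (Q i).
Proof.
move=> be; apply: sub_finite_set (finite_image snd (Qf be)).
by move=> pa /= n; exists (i, pa).
Qed.

Lemma Q_order i : weyl_order_le 2 (Q i).
Proof. by move=> p al be /Qw; lia. Qed.

Lemma Hadd_colfin i : weyl_colfin (Hadd Q i).
Proof.
move=> be; have : finite_set ([set pa | Dop i pa.1 pa.2 be != 0]
   `|` [set pa | Q i pa.1 pa.2 be != 0]).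
  by rewrite finite_setU; split; [exact: Dop_colfin|exact: Q_colfin].
by apply: sub_finite_set => pa /addr_neq0.
Qed.

Lemma Hadd_order i : weyl_order_le 2 (Hadd Q i).
Proof. by move=> p al be /addr_neq0 [/Dop_order|/Q_order]. Qed.

Lemma Hadd_family_colfin : family_colfin (Hadd Q).
Proof.
move=> be; have : finite_set ([set x : I * (nat * mono) | Dop x.1 x.2.1 x.2.2 be != 0]
   `|` [set x | Q x.1 x.2.1 x.2.2 be != 0]).
  rewrite finite_setU; split; last exact: Qf.
  case: (pselect (exists k, mone k = be)) => [[k <-]|nk].
    apply: sub_finite_set (finite_set1 (k, (0%N, mzero I))).
    by move=> [l [p al]] /= /Dop_neq0 [-> -> /mone_inj ->].
  apply: sub_finite_set (@finite_set0 _) => -[l [p al]] /= /Dop_neq0 [_ _ E].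
  by apply: nk; exists l.
by apply: sub_finite_set => x /addr_neq0.
Qed.

Lemma weyl_act_Hadd i f q m : ser_fin f -> weyl_act (Hadd Q i) f q m =
  weyl_act (Q i) f q m - (m i).+1%:R * f (q - 1) (m :+: mone i).
Proof.
move=> ff; rewrite (weyl_actD (P := Q i) (Q := Dop i) (B := 2%N)) //.
- by rewrite weyl_act_Dop.
- exact: Q_colfin.
- exact: Q_order.
- exact: Dop_colfin.
- exact: Dop_order.
- by move=> *; rewrite addrC.
Qed.

Definition wt (q : int) m : int := q *+ 2 + (mdeg m)%:Z.

Lemma weyl_act_Q_local i f f' q m :
  (forall q' m', wt q' m' = wt q m - 2 -> f q' m' = f' q' m') ->
  weyl_act (Q i) f q m = weyl_act (Q i) f' q m.
Proof.
move=> ff'; rewrite !weyl_actE; apply: eq_fsbigr => -[[[p al] be] m'] /set_mem /= d.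
case: (eqVneq (Q i p al be) 0) => [->|/Qw w]; first by rewrite !mul0r.
congr (_ * _); apply: ff'; have := act_dom_deg d; rewrite /wt; lia.
Qed.

End FamilyQ.
End HamiltonianSplit.

(** * Construction of the wave function by weight, and its uniqueness *)

Section WaveFunction.
Variables (R : realType) (I : countType).
Local Notation C := (R[i]).
Local Notation mono := (multiset I).
Implicit Types (m al be ka : mono) (f : ser R I).

Definition ser_finsupp f := finite_set [set x : int * mono | f x.1 x.2 != 0].

(* The series that are power series in hbar and y = x / hbar. *)
Definition ser_vis f := forall q m, f q m != 0 -> 0 <= q + (mdeg m)%:Z.

Lemma ser_finsupp_fin f : ser_finsupp f -> ser_fin f.
Proof.
move=> ff D q; apply: sub_finite_set (finite_image snd ff).
by move=> m /= [_ [q' _ n]]; exists (q', m).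
Qed.

(** A term hbar^p x^al (hbar d)^be raises q + |m| by p + |al|, which is nonnegative. *)
Lemma weyl_act_vis P f : ser_vis f -> ser_vis (weyl_act P f).
Proof.
move=> fv q m /fsum_neq0 [[[[p al] be] m'] d /mulf3_neq0 [_ _ /fv]].
have := act_dom_deg d; lia.
Qed.

(** A primitive for hbar d_i: each monomial is integrated along one variable that occurs in it. For
    a closed family the choice is immaterial. The default 0 normalises the constant term. *)
Definition integ (G : I -> ser R I) : ser R I := fun q m =>
  if ohead (enum_fset (finsupp m)) is Some i
  then G i (q + 1) (m :-: mone i) / (m i)%:R else 0.

Lemma oheadP (T : eqType) (s : seq T) :
  if ohead s is Some x then is_true (x \in s) else s = [::].
Proof. by case: s => //= x s; rewrite mem_head. Qed.

Lemma integ_neq0 G q m : integ G q m != 0 ->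
  exists i m', m = m' :+: mone i /\ G i (q + 1) m' != 0.
Proof.
rewrite /integ; have := oheadP (enum_fset (finsupp m)).
case: ohead => [i im|]; last by rewrite eqxx.
rewrite mulf_eq0 negb_or => /andP[n _]; exists i, (m :-: mone i); split=> //.
have : (0 < m i)%N by move: im; rewrite -[_ \in _]/(i \in finsupp m) finsuppE; lia.
by move=> /mono_split_i [m' ->]; mset_lia.
Qed.

Lemma integ0 G q : integ G q (mzero I) = 0.
Proof.
apply/eqP/negPn/negP => /integ_neq0 [i [m' [/(congr1 (@mdeg I))]]].
by rewrite mdegD mdeg_mone mdeg0 addn1.
Qed.

Lemma integP (G : I -> ser R I) :
  (forall i j q m, (m j).+1%:R * G i q (m :+: mone j) =
                   (m i).+1%:R * G j q (m :+: mone i)) ->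
  forall i q m, (m i).+1%:R * integ G (q - 1) (m :+: mone i) = G i q m.
Proof.
move=> cl i q m; rewrite /integ; have := oheadP (enum_fset (finsupp (m :+: mone i))).
case: ohead => [j jm|E]; last first.
  have : i \in finsupp (m :+: mone i) by rewrite finsuppE msetDE msetnE eqxx addn1.
  by rewrite -[_ \in _]/(i \in enum_fset (finsupp (m :+: mone i))) E.
have jm' : (0 < (m :+: mone i) j)%N.
  by move: jm; rewrite -[_ \in _]/(j \in finsupp (m :+: mone i)) finsuppE; lia.
rewrite subrK; case: (eqVneq j i) => [->|ji].
  rewrite (_ : m :+: mone i :-: mone i = m); last by mset_lia.
  rewrite msetDE msetnE eqxx addn1 mulrC divfK //.
  by rewrite pnatr_eq0.
(* The integration ran along j while the derivative is taken along i. With m = m2 + e_j, closedness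
   at m2 exchanges the two. *)
have /mono_split_i [m2 mE] : (0 < m j)%N.
  by move: jm'; rewrite msetDE msetnE (negbTE ji) addn0.
rewrite {2}mE (_ : m2 :+: mone j :+: mone i :-: mone j = m2 :+: mone i); last by mset_lia.
have -> : m i = m2 i by rewrite mE msetDE msetnE eq_sym (negbTE ji) addn0.
rewrite mulrA cl -mE msetDE msetnE (negbTE ji) addn0 (_ : m j = (m2 j).+1).
  by rewrite mulrC mulKf // pnatr_eq0.
by rewrite mE msetDE msetnE eqxx addn1.
Qed.

Variable Q : I -> weyl R I.
Hypotheses (Qw : Qweight2 Q) (Qf : family_colfin Q).
Local Notation H := (Hadd Q).

Fixpoint psi_ (n : nat) : ser R I :=
  if n is n'.+1 then integ (fun i => weyl_act (Q i) (psi_ n')) else @ser_one R I.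

Lemma wt_mone q m i : wt (q - 1) (m :+: mone i) = wt q m - 1.
Proof. by rewrite /wt mdegD mdeg_mone; lia. Qed.

Lemma weyl_act_Q_wt i f (n : int) q m : (forall q m, f q m != 0 -> wt q m = n) ->
  weyl_act (Q i) f q m != 0 -> wt q m = n + 2.
Proof.
move=> fw /fsum_neq0 [[[[p al] be] m'] d /mulf3_neq0 [/Qw w _ /fw]].
by have := act_dom_deg d; rewrite /wt; lia.
Qed.

Lemma psi_wt n q m : psi_ n q m != 0 -> wt q m = n%:Z.
Proof.
elim: n q m => [|n IH] q m /=.
  by rewrite /ser_one; case: ifP => [/andP[/eqP -> /eqP ->] _|_]; rewrite ?eqxx // /wt mdeg0.
move=> /integ_neq0 [i [m' [-> /(weyl_act_Q_wt IH)]]].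
by have := wt_mone (q + 1) m' i; rewrite addrK => ->; lia.
Qed.

Lemma psi_vis n : ser_vis (psi_ n).
Proof.
elim: n => [|n IH] q m /=.
  by rewrite /ser_one; case: ifP => [/andP[/eqP -> /eqP ->] _|_]; rewrite ?eqxx.
move=> /integ_neq0 [i [m' [-> /(weyl_act_vis IH)]]].
by rewrite mdegD mdeg_mone; lia.
Qed.

Lemma finite_family_act f : ser_finsupp f ->
  finite_set [set x : I * (int * mono) | weyl_act (Q x.1) f x.2.1 x.2.2 != 0].
Proof.
move=> ff.
have fin1 := finite_sigma (B := fun x : int * mono => [set be | msubset be x.2])
  ff (fun x _ => finite_submono _).
have fin2 := finite_sigma (B := fun x : (int * mono) * mono =>
   [set y : I * (nat * mono) | Q y.1 y.2.1 y.2.2 x.2 != 0]) fin1 (fun x _ => Qf _).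
apply: sub_finite_set (finite_image (fun x =>
   let: ((q', m'), be, (i, (p, al))) := x in
   (i, (q' + p%:Z + (mdeg be)%:Z, al :+: m' :-: be))) fin2).
move=> [i [q m]] /= /fsum_neq0 [[[[p al] be] m'] d /mulf3_neq0 [Qn /mffact_neq0 s fn]].
exists ((q - p%:Z - (mdeg be)%:Z, m'), be, (i, (p, al))) => //=.
congr (_, (_, _)); first lia.
by rewrite /= in d; clear -d s; mset_lia.
Qed.

Lemma psi_finsupp n : ser_finsupp (psi_ n).
Proof.
elim: n => [|n IH].
  apply: sub_finite_set (finite_set1 (0%R, mzero I)) => -[q m] /=.
  by rewrite /ser_one; case: ifP => [/andP[/eqP -> /eqP ->]|_] //; rewrite eqxx.
apply: sub_finite_set (finite_image (fun x : I * (int * mono) =>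
  (x.2.1 - 1, x.2.2 :+: mone x.1)) (finite_family_act IH)).
move=> [q m] /= /integ_neq0 [i [m' [-> n']]]; exists (i, (q + 1, m')) => //=.
by rewrite addrK.
Qed.

Definition psile n : ser R I := fun q m =>
  if wt q m is Posz k then if (k <= n)%N then psi_ k q m else 0 else 0.

Definition psi : ser R I := fun q m => if wt q m is Posz k then psi_ k q m else 0.

Lemma psile_finsupp n : ser_finsupp (psile n).
Proof.
apply: (@sub_finite_set _ _ (\bigcup_(k in `I_n.+1)
   [set x : int * mono | psi_ k x.1 x.2 != 0])).
  move=> [q m] /=; rewrite /psile; case: (wt q m) => k; last by rewrite eqxx.
  by case: ifP => [kn nz|_]; [exists k|rewrite eqxx].
by apply: bigcup_finite => [|k _]; [exact: finite_II|exact: psi_finsupp].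
Qed.

Lemma psileE n q m k : wt q m = k%:Z -> (k <= n)%N -> psile n q m = psi_ k q m.
Proof. by rewrite /psile => -> ->. Qed.

Lemma psile_out n q m : wt q m < 0 \/ n%:Z < wt q m -> psile n q m = 0.
Proof. by rewrite /psile; case: (wt q m) => k //; case: ifP => //; lia. Qed.

Lemma weyl_act0 P q m : weyl_act P (@ser0 R I) q m = 0.
Proof. by apply: fsbig1 => -[[[p al] be] m'] _; rewrite mulr0. Qed.

Lemma weyl_act_Q_psile i n k q m : wt q m = k%:Z + 2 -> (k <= n)%N ->
  weyl_act (Q i) (psile n) q m = weyl_act (Q i) (psi_ k) q m.
Proof.
move=> w kn; apply: weyl_act_Q_local => // q' m' w'; apply: psileE => //.
by rewrite w' w addrK.
Qed.

Lemma weyl_act_Q_out i n q m : wt q m < 2 \/ n%:Z + 2 < wt q m ->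
  weyl_act (Q i) (psile n) q m = 0.
Proof.
move=> w; rewrite -(weyl_act0 (Q i) q m); apply: weyl_act_Q_local => // q' m' w'.
by apply: psile_out; lia.
Qed.

Definition psi_step n := forall i q m,
  (m i).+1%:R * psi_ n.+1 (q - 1) (m :+: mone i) = weyl_act (Q i) (psi_ n) q m.

Lemma one_mone q m i : ser_one R (I:=I) q (m :+: mone i) = 0.
Proof.
rewrite /ser_one; case: ifP => // /andP[_ /eqP /(congr1 (@mdeg I))].
by rewrite mdegD mdeg_mone mdeg0 addn1.
Qed.

(** Telescoping: hbar d_i psi_(k+1) cancels Q_i psi_k for k < n, and psi_0 = 1 has no derivative, so
    only the top term is left. *)
Lemma weyl_act_H_psile n i : (forall k, (k < n)%N -> psi_step k) ->
  weyl_act (H i) (psile n) = weyl_act (Q i) (psi_ n).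
Proof.
move=> st; apply/funext => q; apply/funext => m.
rewrite weyl_act_Hadd //; last exact/ser_finsupp_fin/psile_finsupp.
have w1 := wt_mone q m i.
have Gout : wt q m != n%:Z + 2 -> weyl_act (Q i) (psi_ n) q m = 0.
  by apply: contraNeq => /(weyl_act_Q_wt (@psi_wt n)) ->.
case: (ltrP (wt q m) 1) => [lt1|ge1].
  by rewrite weyl_act_Q_out ?psile_out ?Gout ?mulr0 ?subr0 // ?w1; lia.
case: (ltrP (n%:Z + 2) (wt q m)) => [lt2|ge2].
  by rewrite weyl_act_Q_out ?psile_out ?Gout ?mulr0 ?subr0 // ?w1; lia.
have [k wk] : exists k : nat, wt q m = k%:Z + 1 by exists `|wt q m - 1|%N; lia.
rewrite wk addrK in w1; case: k wk w1 => [|k] wk w1.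
  rewrite weyl_act_Q_out ?Gout; [|lia|lia].
  by rewrite (psileE w1) //= one_mone mulr0 subr0.
rewrite (@weyl_act_Q_psile _ _ k); [|lia|lia].
case: (eqVneq k n) => [kE|kn]; first by rewrite kE psile_out ?mulr0 ?subr0 // w1; lia.
rewrite (psileE w1); last lia.
by rewrite st ?subrr ?Gout //; lia.
Qed.

Hypothesis Hcomm : forall i j, exists g : I -> C,
  weyl_comm (H i) (H j) = weyl_hbar (weyl_lincomb g H).

Lemma psi_closed n : (forall k, (k < n)%N -> psi_step k) -> forall i j q m,
  (m j).+1%:R * weyl_act (Q i) (psi_ n) q (m :+: mone j) =
  (m i).+1%:R * weyl_act (Q j) (psi_ n) q (m :+: mone i).
Proof.
move=> st i j q m; have fin := ser_finsupp_fin (psile_finsupp n).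
have Gw k q' m' : weyl_act (Q k) (psi_ n) q' m' != 0 -> wt q' m' = n%:Z + 2.
  exact/(weyl_act_Q_wt (@psi_wt n)).
have Gfin k : ser_fin (weyl_act (Q k) (psi_ n)).
  apply: (weyl_act_ser_fin (B := 2%N)); [exact: Q_colfin|exact: Q_order|].
  exact/ser_finsupp_fin/psi_finsupp.
(* The cross derivatives at (q, m + e_j) are read in the commutator relation at (q + 1, m). In any
   weight other than n + 3 both sides vanish by homogeneity. *)
case: (eqVneq (wt (q + 1) m) (n%:Z + 3)) => [W|W]; last first.
  have wE k : wt q (m :+: mone k) = wt (q + 1) m - 1.
    by rewrite -(wt_mone (q + 1) m k) addrK.
  have z k l : weyl_act (Q k) (psi_ n) q (m :+: mone l) = 0.
    by apply/eqP/negPn/negP => /Gw; rewrite wE; move/eqP: W; lia.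
  by rewrite !z !mulr0.
have [g /(weyl_act_comm (B := 2%N) (q + 1) m)] := Hcomm i j.
move=> /(_ _ (@Hadd_colfin _ _ _ Qf i) (@Hadd_order _ _ _ Qw i)
  (@Hadd_colfin _ _ _ Qf j) (@Hadd_order _ _ _ Qw j) fin).
rewrite weyl_act_hbar (weyl_act_lincomb _ _ _ (Hadd_family_colfin Qf) (@Hadd_order _ _ _ Qw) fin).
(* With hbar pulled out, the right side is evaluated in weight n + 1, while each H_k yields Q_k
   psi_n, of weight n + 2. *)
rewrite fsbig1; last first.
  move=> k _; rewrite weyl_act_H_psile //; apply/eqP; rewrite mulf_eq0; apply/orP; right.
  by apply/negPn/negP => /Gw; rewrite /wt in W *; lia.
rewrite !weyl_act_H_psile // !weyl_act_Hadd // addrK.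
(* Two applications of Q lead to weight n + 4, so only the terms with hbar d survive. *)
have z k l : weyl_act (Q k) (weyl_act (Q l) (psi_ n)) (q + 1) m = 0.
  by apply/eqP/negPn/negP => /(weyl_act_Q_wt (@Gw l)); lia.
by rewrite !z !sub0r opprK => /eqP; rewrite eq_sym addrC subr_eq0 => /eqP.
Qed.

Lemma psi_stepP n : psi_step n.
Proof.
elim/ltn_ind: n => n IH i q m; exact: (integP (psi_closed IH)).
Qed.

(** Degree at most D and hbar exponent at most q' bound the weight by 2q' + D, so a partial sum,
    which is a polynomial, sees all monomials concerned. *)
Lemma psi_fin : ser_fin psi.
Proof.
move=> D q'; have := psile_finsupp `|q' *+ 2 + D%:Z|.
move=> /(finite_image snd); apply: sub_finite_set => m' /= [mD [q1 q1q n1]].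
exists (q1, m') => //=; move: n1; rewrite /psile /psi /wt.
case E: (_ + _) => [k|k] //; rewrite ifT //; lia.
Qed.

Lemma psi_ker i q m : weyl_act (H i) psi q m = 0.
Proof.
have fin := psi_fin.
rewrite weyl_act_Hadd //.
(* A cutoff n >= wt q m suffices: at (q, m) the operator sees only components of weight below wt q
   m, and the defect Q_i psi_n of the partial sum has weight n + 2. *)
pose n := `|wt q m|%N.
rewrite (@weyl_act_Q_local _ _ _ Qw _ _ (psile n)); last first.
  move=> q' m' w'; rewrite /psi /psile; case E: (wt q' m') => [k|k] //.
  by rewrite ifT //; lia.
have -> : psi (q - 1) (m :+: mone i) = psile n (q - 1) (m :+: mone i).
  rewrite /psi /psile wt_mone; case E: (_ - _) => [k|k] //.
  by rewrite ifT //; lia.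
rewrite -weyl_act_Hadd //; last exact/ser_finsupp_fin/psile_finsupp.
rewrite weyl_act_H_psile; last by move=> *; exact: psi_stepP.
by apply/eqP/negPn/negP => /(weyl_act_Q_wt (@psi_wt n)); lia.
Qed.

Lemma psi_tot_vis : ser_vis psi.
Proof.
by move=> q m; rewrite /psi; case: (wt q m) => k; [exact: psi_vis|rewrite eqxx].
Qed.

Lemma psi_wt_ge0 q m : psi q m != 0 -> 0 <= wt q m.
Proof. by rewrite /psi; case: (wt q m) => k //; rewrite eqxx. Qed.

Lemma psi_wt0 q m : wt q m = 0 -> psi q m = ser_one R q m.
Proof. by rewrite /psi => ->. Qed.

Lemma psi_mzero q : psi q (mzero I) = ser_one R q (mzero I).
Proof.
rewrite /psi; case E: (wt q _) => [[|k]|k] //=.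
  rewrite integ0 /ser_one; case: eqP => // q0.
  by move: E; rewrite q0 /wt mdeg0.
by rewrite /ser_one; case: eqP => // q0; move: E; rewrite q0 /wt mdeg0.
Qed.

(** Induction on the weight, started by the lower bound 0. The equation expresses hbar d_i f through
    components of lower weight, and m_i + 1 is invertible, so only the constant terms are free. *)
Lemma ker_uniq f f' : ser_fin f -> ser_fin f' ->
  (forall q m, f q m != 0 -> 0 <= wt q m) ->
  (forall q m, f' q m != 0 -> 0 <= wt q m) ->
  (forall q, f q (mzero I) = f' q (mzero I)) ->
  (forall i q m, weyl_act (H i) f q m = 0) ->
  (forall i q m, weyl_act (H i) f' q m = 0) -> f = f'.
Proof.
move=> fin fin' w w' f0 hf hf'.
suff E (n : nat) q m : wt q m < n%:Z -> f q m = f' q m.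
  by apply/funext => q; apply/funext => m; apply: (E `|wt q m|.+1); lia.
elim: n q m => [|n IH] q m wn.
  have /eqP -> : f q m == 0 by apply: contraTT wn => /w; lia.
  by apply/esym/eqP; apply: contraTT wn => /w'; lia.
case: (mono_split m) => [-> //|[i [m' mE]]].
have := hf i (q + 1) m'; have := hf' i (q + 1) m'.
rewrite !weyl_act_Hadd // addrK -mE (@weyl_act_Q_local _ _ _ Qw _ f' f); last first.
  move=> q1 m1 w1; apply/esym/IH; move: (wt_mone (q + 1) m' i).
  by rewrite addrK -mE; lia.
move=> /eqP; rewrite subr_eq0 => /eqP -> /eqP; rewrite subr_eq0.
by move=> /eqP /(mulfI _) -> //; rewrite pnatr_eq0.
Qed.

End WaveFunction.

(* Power series in hbar and y = x / hbar: every exponent has finitely many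
   decompositions, so no support condition is needed to multiply. *)
Definition hser (R : realType) (I : countType) := nat -> multiset I -> R[i].

(** * The ring of power series in hbar and y: derivations, exp and log *)

Section PowerSeries.
Variables (R : realType) (I : countType).
Local Notation C := (R[i]).
Local Notation mono := (multiset I).
Local Notation A := (hser R I).
Implicit Types (m : mono) (f g h : A).

HB.instance Definition _ := gen_eqMixin A.
HB.instance Definition _ := gen_choiceMixin A.

Lemma hserP f g : (forall u m, f u m = g u m) -> f = g.
Proof. by move=> E; apply/funext => u; apply/funext => m. Qed.

Definition hser_add f g : A := fun u m => f u m + g u m.
Definition hser_opp f : A := fun u m => - f u m.
Definition hser_zero : A := fun u m => 0.

Lemma hser_addA : associative hser_add.
Proof. by move=> f g h; apply: hserP => u m; rewrite /hser_add addrA. Qed.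
Lemma hser_addC : commutative hser_add.
Proof. by move=> f g; apply: hserP => u m; rewrite /hser_add addrC. Qed.
Lemma hser_add0 : left_id hser_zero hser_add.
Proof. by move=> f; apply: hserP => u m; rewrite /hser_add add0r. Qed.
Lemma hser_addN : left_inverse hser_zero hser_opp hser_add.
Proof. by move=> f; apply: hserP => u m; rewrite /hser_add addNr. Qed.

HB.instance Definition _ :=
  GRing.isZmodule.Build A hser_addA hser_addC hser_add0 hser_addN.

Local Notation K := (nat * mono)%type.
Definition kadd (a b : K) : K := ((a.1 + b.1)%N, a.2 :+: b.2).

Lemma kaddC a b : kadd a b = kadd b a.
Proof. by rewrite /kadd addnC msetDC. Qed.

Lemma kaddA a b c : kadd a (kadd b c) = kadd (kadd a b) c.
Proof. by rewrite /kadd /= addnA msetDA. Qed.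

Definition dec (k : K) : set (K * K) := [set x | kadd x.1 x.2 = k].

Lemma finite_dec k : finite_set (dec k).
Proof.
have fin : finite_set (`I_k.1.+1 `*` [set m : mono | msubset m k.2]).
  by apply: finite_setX; [exact: finite_II|exact: finite_submono].
apply: sub_finite_set (finite_setX fin fin) => -[[u1 m1] [u2 m2]].
rewrite /dec /kadd /= => <- /=; split; split=> /=; try lia; mset_lia.
Qed.

Definition coefk f (k : K) : C := f k.1 k.2.

Definition hser_mul f g : A := fun u m =>
  \sum_(x \in dec (u, m)) coefk f x.1 * coefk g x.2.

Lemma hser_mulC : commutative hser_mul.
Proof.
move=> f g; apply: hserP => u m; rewrite /hser_mul.
apply: (fsum_bij (h := fun x => (x.2, x.1)) (k := fun x => (x.2, x.1)));
  by move=> [a b] E _; split; [rewrite /dec /= kaddC | | rewrite mulrC].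
Qed.

Lemma hser_mulA : associative hser_mul.
Proof.
move=> f g h; apply: hserP => u m.
transitivity (\sum_(x \in dec (u, m)) \sum_(y \in dec x.2)
   coefk f x.1 * (coefk g y.1 * coefk h y.2)).
  by apply: eq_fsbigr => -[a [ub mb]] _; rewrite mulr_fsumr.
transitivity (\sum_(x \in dec (u, m)) \sum_(y \in dec x.1)
   coefk f y.1 * coefk g y.2 * coefk h x.2); last first.
  by apply: eq_fsbigr => -[[ua ma] b] _; rewrite -mulr_fsuml.
have fin1 : finite_set [set x : (K * K) * (K * K) | dec (u, m) x.1 /\ dec x.1.2 x.2].
  exact: (finite_sigma (B := fun x : K * K => dec x.2) (finite_dec _)
     (fun x _ => finite_dec _)).
have fin2 : finite_set [set x : (K * K) * (K * K) | dec (u, m) x.1 /\ dec x.1.1 x.2].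
  exact: (finite_sigma (B := fun x : K * K => dec x.1) (finite_dec _)
     (fun x _ => finite_dec _)).
rewrite !fsum_sigma; first last.
- by apply: sub_finite_set fin1 => x [].
- by apply: sub_finite_set fin2 => x [].
apply: (fsum_bij (h := fun x => ((kadd x.1.1 x.2.1, x.2.2), (x.1.1, x.2.1)))
                 (k := fun x => ((x.2.1, kadd x.2.2 x.1.2), (x.2.2, x.1.2)))).
- move=> [[a b] [c d]] /= [E1 E2] _; rewrite /dec /= in E1 E2 *; split.
  + by rewrite -kaddA E2.
  + by rewrite E2.
  + by rewrite mulrA.
- move=> [[a b] [c d]] /= [E1 E2] _; rewrite /dec /= in E1 E2 *; split.
  + by rewrite kaddA E2.
  + by rewrite E2.
  + by rewrite mulrA.
Qed.

Definition hser_cst (c : C) : A := fun u m => if (u == 0%N) && (m == mzero I) then c else 0.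

Lemma hser_mulcst c f u m : hser_mul (hser_cst c) f u m = c * f u m.
Proof.
rewrite /hser_mul (fsum1 (t0 := ((0%N, mzero I), (u, m)))).
- by rewrite /coefk /hser_cst /= !eqxx.
- by rewrite /dec /kadd /= add0n /mzero mset0D.
- move=> [[u1 m1] [u2 m2]]; rewrite /dec /kadd /coefk /hser_cst /= => E.
  rewrite mulf_eq0 negb_or => /andP[/if_neq0[/andP[/eqP e1 /eqP e2] _] _].
  by move: E; rewrite e1 e2 add0n /mzero mset0D => ->.
Qed.

Lemma hser_mul1 : left_id (hser_cst 1) hser_mul.
Proof. by move=> f; apply: hserP => u m; rewrite hser_mulcst mul1r. Qed.

Lemma hser_mulDl : left_distributive hser_mul hser_add.
Proof.
move=> f g h; apply: hserP => u m.
rewrite /hser_mul /hser_add -fsbig_split /=; last exact: finite_dec.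
by apply: eq_fsbigr => x _; rewrite /coefk mulrDl.
Qed.

Lemma hser_1neq0 : hser_cst 1 != 0.
Proof.
apply/eqP => /(congr1 (fun f : A => f 0%N (mzero I))).
by rewrite /hser_cst !eqxx => /eqP; rewrite oner_eq0.
Qed.

HB.instance Definition _ := GRing.Zmodule_isComNzRing.Build A
  hser_mulA hser_mulC hser_mul1 hser_mulDl hser_1neq0.

Lemma coefD f g u m : (f + g) u m = f u m + g u m. Proof. by []. Qed.
Lemma coefN f u m : (- f) u m = - f u m. Proof. by []. Qed.
Lemma coef0 u m : (0 : A) u m = 0. Proof. by []. Qed.
Lemma coef1 u m : (1 : A) u m = if (u == 0%N) && (m == mzero I) then 1 else 0.
Proof. by []. Qed.
Lemma coefM f g u m : (f * g) u m =
  \sum_(x \in dec (u, m)) coefk f x.1 * coefk g x.2.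
Proof. by []. Qed.
Lemma coef_cst c f u m : (hser_cst c * f) u m = c * f u m.
Proof. exact: hser_mulcst. Qed.
Lemma coefMn f n u m : (f *+ n) u m = f u m *+ n.
Proof. by elim: n => [|n IH]; rewrite ?mulr0n // !mulrS coefD IH. Qed.
Lemma coef_sum (T : Type) (s : seq T) (P : pred T) (F : T -> A) u m :
  (\sum_(i <- s | P i) F i) u m = \sum_(i <- s | P i) F i u m.
Proof. exact: (big_morph (fun f : A => f u m) (fun f g => coefD f g u m) (coef0 u m)). Qed.

Lemma coefM_neq0 f g u m : (f * g) u m != 0 -> exists u1 m1 u2 m2,
  [/\ u = (u1 + u2)%N, m = m1 :+: m2, f u1 m1 != 0 & g u2 m2 != 0].
Proof.
move=> /fsum_neq0 [[[u1 m1] [u2 m2]]]; rewrite /dec /kadd /= => -[<- <-].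
by rewrite mulf_eq0 negb_or => /andP[n1 n2]; exists u1, m1, u2, m2.
Qed.

Definition der (i : I) f : A := fun u m => (m i).+1%:R * f u (m :+: mone i).

Lemma derD i f g : der i (f + g) = der i f + der i g.
Proof. by apply: hserP => u m; rewrite /der !coefD mulrDr. Qed.
Lemma derN i f : der i (- f) = - der i f.
Proof. by apply: hserP => u m; rewrite /der !coefN mulrN. Qed.
Lemma derB i f g : der i (f - g) = der i f - der i g.
Proof. by rewrite derD derN. Qed.
Lemma der0 i : der i 0 = 0.
Proof. by apply: hserP => u m; rewrite /der mulr0. Qed.
Lemma der_sum i (T : Type) (s : seq T) (P : pred T) (F : T -> A) :
  der i (\sum_(t <- s | P t) F t) = \sum_(t <- s | P t) der i (F t).
Proof. exact: (big_morph (der i) (derD i) (der0 i)). Qed.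

Lemma der_cst i c : der i (hser_cst c) = 0.
Proof.
apply: hserP => u m; rewrite /der /hser_cst; case: ifP => [/andP[_ /eqP E]|_].
  by move/(congr1 (@mdeg I)): E; rewrite mdegD mdeg_mone mdeg0 addn1.
by rewrite mulr0.
Qed.

(** The derivative as a weight on decompositions of m + e_i: the exponent of i in the first factor.
    The Leibniz rule then says that this exponent is additive over the two factors. *)
Lemma der_mulE i f g u m : (der i f * g) u m =
  \sum_(x \in dec (u, m :+: mone i)) (x.1.2 i)%:R * (coefk f x.1 * coefk g x.2).
Proof.
rewrite coefM; apply: (fsum_bij
  (h := fun x : K * K => ((x.1.1, x.1.2 :+: mone i), x.2))
  (k := fun x : K * K => ((x.1.1, x.1.2 :-: mone i), x.2))).
- move=> [[u1 m1] [u2 m2]]; rewrite /dec /kadd /coefk /der /= => -[<- <-] _; split.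
  + by congr pair; rewrite msetDAC.
  + by congr (_, _, _); mset_lia.
  + by rewrite msetDE msetnE eqxx addn1 mulrA.
- move=> [[u1 m1] [u2 m2]]; rewrite /dec /kadd /coefk /der /= => -[<- E].
  rewrite !mulf_eq0 !negb_or pnatr_eq0 -lt0n => /andP[/mono_split_i [m1' mE] _].
  have E' : m1 :-: mone i = m1' by rewrite mE; mset_lia.
  rewrite E' -mE; split=> //.
  + by congr pair; rewrite mE in E; clear -E; mset_lia.
  + by rewrite mE msetDE msetnE eqxx addn1 mulrA.
Qed.

Lemma derM i f g : der i (f * g) = der i f * g + f * der i g.
Proof.
apply: hserP => u m; rewrite coefD [f * der i g]mulrC !der_mulE.
rewrite (_ : \sum_(x \in _) _ * (coefk g x.1 * _) =
   \sum_(x \in dec (u, m :+: mone i)) (x.2.2 i)%:R * (coefk f x.1 * coefk g x.2)).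
  rewrite /der coefM mulr_fsumr -fsbig_split /=; last exact: finite_dec.
  apply: eq_fsbigr => -[[u1 m1] [u2 m2]] /set_mem; rewrite /dec /kadd /= => -[_ E].
  rewrite -mulrDl -natrD; congr (_%:R * _).
  by have := congr1 (fun m : mono => m i) E; rewrite !msetDE msetnE eqxx addn1.
apply: (fsum_bij (h := fun x => (x.2, x.1)) (k := fun x => (x.2, x.1)));
  by move=> [a b] E _; split; [rewrite /dec /= kaddC | | rewrite [coefk f _ * _]mulrC].
Qed.

Lemma derX i f n : der i (f ^+ n.+1) = n.+1%:R * f ^+ n * der i f.
Proof.
elim: n => [|n IH]; first by rewrite expr1 expr0 !mul1r.
by rewrite exprS derM IH -[in RHS]natr1 !exprS; ring.
Qed.

(** The filtration by order in y, uniformly in hbar: [low 1] is vanishing at y = 0 for every power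
    of hbar. *)
Definition low n f := forall u m, (mdeg m < n)%N -> f u m = 0.

Lemma lowD n f g : low n f -> low n g -> low n (f + g).
Proof. by move=> Hf Hg u m mn; rewrite coefD Hf // Hg // addr0. Qed.
Lemma lowN n f : low n f -> low n (- f).
Proof. by move=> Hf u m mn; rewrite coefN Hf // oppr0. Qed.
Lemma lowB n f g : low n f -> low n g -> low n (f - g).
Proof. by move=> Hf /lowN; exact: lowD. Qed.
Lemma low0 f : low 0 f. Proof. by []. Qed.

Lemma lowM a b f g : low a f -> low b g -> low (a + b) (f * g).
Proof.
move=> Hf Hg u m mn; apply/eqP/negPn/negP => /coefM_neq0 [u1 [m1 [u2 [m2 [_ mE n1 n2]]]]].
have : (a <= mdeg m1)%N by rewrite leqNgt; apply: contra n1 => /Hf ->.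
have : (b <= mdeg m2)%N by rewrite leqNgt; apply: contra n2 => /Hg ->.
by move: mn; rewrite mE mdegD; lia.
Qed.

Lemma lowMl a f g : low a f -> low a (f * g).
Proof. by move=> Hf; rewrite -[a]addn0; apply: lowM => //; exact: low0. Qed.
Lemma lowMr a f g : low a g -> low a (f * g).
Proof. by rewrite mulrC; exact: lowMl. Qed.

Lemma lowX f n : low 1 f -> low n (f ^+ n).
Proof. by move=> Hf; elim: n => [|n IH]; [exact: low0|rewrite exprS -add1n; exact: lowM]. Qed.

Lemma low_der n i f : low n.+1 f -> low n (der i f).
Proof. by move=> Hf u m mn; rewrite /der Hf ?mulr0 // mdegD mdeg_mone addn1. Qed.

Lemma low_eq0 f : (forall n, low n f) -> f = 0.
Proof. by move=> H; apply: hserP => u m; rewrite (H (mdeg m).+1). Qed.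

Lemma low_of_der n f : (forall i, low n (der i f)) -> low 1 f -> low n.+1 f.
Proof.
move=> Hd f0 u m mn; case: (mono_split m) => [->|[i [m' mE]]].
  by rewrite f0 // mdeg0.
have /(_ u m') := Hd i; move: mn; rewrite mE mdegD mdeg_mone addn1 ltnS => mn /(_ mn) /eqP.
by rewrite /der mulf_eq0 pnatr_eq0 /= => /eqP.
Qed.

Lemma der_inj f g : (forall i, der i f = der i g) -> low 1 f -> low 1 g -> f = g.
Proof.
move=> E f1 g1; apply/eqP; rewrite -subr_eq0; apply/eqP; apply: low_eq0; case=> [//|n].
apply: low_of_der; last exact: lowB.
by move=> i u m _; rewrite derB E subrr.
Qed.

(** Here f = - (w - 1) f, and w - 1 raises the order in y, so f has every order. *)
Lemma unipotent_mul_eq0 w f : low 1 (w - 1) -> w * f = 0 -> f = 0.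
Proof.
move=> wu wf; apply: low_eq0; elim=> [//|n IH].
have -> : f = - ((w - 1) * f) by rewrite mulrBl wf mul1r sub0r opprK.
by apply: lowN; rewrite -add1n; exact: lowM.
Qed.

(** The difference e satisfies d_i e = e G_i too: if e has order n, so have its derivatives, and
    then e has order n + 1. *)
Lemma der_linear_uniq (f g : A) (G : I -> A) : (forall i, der i f = f * G i) ->
  (forall i, der i g = g * G i) -> low 1 (f - g) -> f = g.
Proof.
move=> Ef Eg fg; apply/eqP; rewrite -subr_eq0; apply/eqP; apply: low_eq0.
elim=> [//|n IH]; apply: low_of_der => // i.
by rewrite derB Ef Eg -mulrBl; exact: lowMl.
Qed.

Definition exp_trunc f n : A := \sum_(r < n) hser_cst (r`!%:R^-1) * f ^+ r.
(** If f vanishes at y = 0, then f^r starts in degree r, so the coefficient at m is final once the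
    powers up to |m| are included. *)
Definition hser_exp f : A := fun u m => exp_trunc f (mdeg m).+1 u m.

Lemma exp_truncE f n u m : low 1 f -> (mdeg m < n)%N ->
  exp_trunc f n u m = hser_exp f u m.
Proof.
move=> f1 mn; rewrite /hser_exp /exp_trunc !coef_sum.
rewrite -!(big_mkord xpredT (fun r => (hser_cst (r`!%:R^-1) * f ^+ r) u m)).
rewrite (big_cat_nat (n := (mdeg m).+1)) //=.
rewrite [X in _ + X]big_nat_cond [X in _ + X]big1 ?addr0 // => r /andP[/andP[mr _] _].
by rewrite coef_cst (lowX f1) // mulr0.
Qed.

Lemma low_exp_trunc f n : low 1 f -> low n (hser_exp f - exp_trunc f n).
Proof. by move=> f1 u m mn; rewrite coefD coefN exp_truncE // subrr. Qed.

Lemma hser_exp_unipotent f : low 1 (hser_exp f - 1).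
Proof.
move=> u m; rewrite ltnS leqn0 => /eqP/mdeg_eq0 ->.
rewrite coefD coefN /hser_exp /exp_trunc mdeg0 big_ord_recl big_ord0 addr0.
by rewrite coef_cst expr0 fact0 invr1 mul1r subrr.
Qed.

Lemma hser_cst_natr c n : hser_cst c * n%:R = hser_cst (c * n%:R).
Proof.
apply: hserP => u m; rewrite mulr_natr coefMn /hser_cst.
by case: ifP => _; rewrite ?mul0rn // mulr_natr.
Qed.

Lemma der_exp_trunc i f n : der i (exp_trunc f n.+1) = exp_trunc f n * der i f.
Proof.
rewrite /exp_trunc big_ord_recl expr0 mulr1 derD der_cst add0r der_sum mulr_suml.
apply: eq_bigr => r _; rewrite derM der_cst mul0r add0r derX /= /bump /= add1n.
have <- : hser_cst (r.+1`!%:R^-1) * r.+1%:R = hser_cst (r`!%:R^-1).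
  rewrite hser_cst_natr factS natrM invfM mulrAC mulVf ?mul1r //.
  by rewrite pnatr_eq0.
by rewrite !mulrA.
Qed.

Lemma der_exp i f : low 1 f -> der i (hser_exp f) = hser_exp f * der i f.
Proof.
move=> f1; apply/eqP; rewrite -subr_eq0; apply/eqP; apply: low_eq0 => n.
have -> : der i (hser_exp f) - hser_exp f * der i f =
  der i (hser_exp f - exp_trunc f n.+1) - (hser_exp f - exp_trunc f n) * der i f.
  by rewrite derB der_exp_trunc; ring.
apply: lowB; first exact/low_der/low_exp_trunc.
exact/lowMl/low_exp_trunc.
Qed.

Definition log_trunc v n : A := \sum_(r < n) hser_cst ((-1) ^+ r / r.+1%:R) * v ^+ r.+1.
(** The cutoff is |m| and not |m| + 1, because the summand of index r is a multiple of v^(r+1). *)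
Definition hser_log f : A := fun u m => log_trunc (f - 1) (mdeg m) u m.

Lemma log_truncE f n u m : low 1 (f - 1) -> (mdeg m <= n)%N ->
  log_trunc (f - 1) n u m = hser_log f u m.
Proof.
move=> f1 mn; rewrite /hser_log /log_trunc !coef_sum.
rewrite -!(big_mkord xpredT (fun r => (hser_cst ((-1) ^+ r / r.+1%:R) * (f - 1) ^+ r.+1) u m)).
rewrite (big_cat_nat (n := mdeg m)) //=.
rewrite [X in _ + X]big_nat_cond [X in _ + X]big1 ?addr0 // => r /andP[/andP[mr _] _].
by rewrite coef_cst (lowX f1) ?mulr0 // ltnS.
Qed.

Lemma low_log f : low 1 (hser_log f).
Proof.
move=> u m; rewrite ltnS leqn0 => /eqP/mdeg_eq0 ->.
by rewrite /hser_log mdeg0 /log_trunc big_ord0.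
Qed.

Lemma low_log_trunc f n : low 1 (f - 1) -> low n.+1 (hser_log f - log_trunc (f - 1) n).
Proof. by move=> f1 u m mn; rewrite coefD coefN log_truncE // subrr. Qed.

Lemma hser_cstX c n : hser_cst (c ^+ n) = hser_cst c ^+ n.
Proof.
elim: n => [|n IH]; first by rewrite !expr0.
rewrite !exprS -IH; apply: hserP => u m; rewrite coef_cst /hser_cst.
by case: ifP => _; rewrite ?mulr0.
Qed.

Lemma hser_cstN1 : hser_cst (-1) = -1.
Proof.
by apply: hserP => u m; rewrite coefN coef1 /hser_cst; case: ifP; rewrite ?oppr0.
Qed.

(** The derivative of the truncated logarithm is a geometric sum in - v times d_i v, and 1 + v makes
    it telescope. *)
Lemma der_log_trunc i v n :
  (1 + v) * der i (log_trunc v n) = (1 - (- v) ^+ n) * der i v.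
Proof.
have -> : der i (log_trunc v n) = (\sum_(r < n) (- v) ^+ r) * der i v.
  rewrite /log_trunc der_sum mulr_suml; apply: eq_bigr => r _.
  rewrite derM der_cst mul0r add0r derX.
  have E : hser_cst ((-1) ^+ r / r.+1%:R) * r.+1%:R = (-1) ^+ r.
    rewrite hser_cst_natr divfK; first by rewrite hser_cstX hser_cstN1.
    by rewrite pnatr_eq0.
  by rewrite -[in RHS]mulN1r exprMn -E !mulrA.
have <- : (1 + v) * (\sum_(r < n) (- v) ^+ r) = 1 - (- v) ^+ n; last by rewrite mulrA.
elim: n => [|n IH]; first by rewrite big_ord0 expr0 subrr mulr0.
by rewrite big_ord_recr /= mulrDr IH exprS; ring.
Qed.

Lemma der_log i f : low 1 (f - 1) -> der i f = f * der i (hser_log f).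
Proof.
move=> f1; apply/eqP; rewrite -subr_eq0; apply/eqP; apply: low_eq0 => n.
have E := der_log_trunc i (f - 1) n; rewrite addrC subrK in E.
have derf : der i (f - 1) = der i f by rewrite derB der_cst subr0.
(* Both error terms, from the geometric sum and from the truncation, have order n; n is
   arbitrary. *)
have -> : der i f - f * der i (hser_log f) =
   (- (f - 1)) ^+ n * der i f - f * der i (hser_log f - log_trunc (f - 1) n).
  by rewrite derB mulrBr E derf; ring.
apply: lowB; first by apply/lowMl/lowX; exact: lowN.
by apply/lowMr/low_der; exact: low_log_trunc.
Qed.

(** Both sides solve d_i g = g d_i (log f) and equal 1 at y = 0. *)
Lemma hser_logK f : low 1 (f - 1) -> hser_exp (hser_log f) = f.
Proof.
move=> f1; apply: (der_linear_uniq (G := fun i => der i (hser_log f))).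
- by move=> i; apply: der_exp; exact: low_log.
- by move=> i; exact: der_log.
- rewrite -[X in low _ X](subrKA 1); apply: lowD; first exact: hser_exp_unipotent.
  by rewrite -opprB; exact: lowN.
Qed.

Definition hser_fin f := forall (D u : nat), finite_set
  [set m : mono | (mdeg m <= D)%N /\ exists2 u', (u' <= u)%N & f u' m != 0].

Lemma hser_fin1 : hser_fin 1.
Proof.
move=> D u; apply: sub_finite_set (finite_set1 (mzero I)) => m /= [_ [u' _]].
by rewrite coef1; case: ifP => [/andP[_ /eqP ->]|]; rewrite ?eqxx.
Qed.

Lemma hser_finM f g : hser_fin f -> hser_fin g -> hser_fin (f * g).
Proof.
move=> ff fg D u.
apply: sub_finite_set (finite_image2 (@msetD I) (ff D u) (fg D u)).
move=> m /= [mD [u' uu' /coefM_neq0 [u1 [m1 [u2 [m2 [uE mE n1 n2]]]]]]].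
move: mD; rewrite mE mdegD => mD.
exists m1; first by split; [lia|exists u1 => //; lia].
exists m2 => //; by split; [lia|exists u2 => //; lia].
Qed.

Lemma hser_finX f n : hser_fin f -> hser_fin (f ^+ n).
Proof.
by move=> ff; elim: n => [|n IH]; [exact: hser_fin1|rewrite exprS; exact: hser_finM].
Qed.

Lemma hser_fin_exp f : hser_fin f -> hser_fin (hser_exp f).
Proof.
move=> ff D u.
have fin : finite_set (\bigcup_(r in `I_D.+1)
   [set m : mono | (mdeg m <= D)%N /\ exists2 u', (u' <= u)%N & (f ^+ r) u' m != 0]).
  by apply: bigcup_finite => [|r _]; [exact: finite_II|exact: hser_finX].
apply: sub_finite_set fin => m /= [mD [u' uu' n]].
have [r n'] : exists r : 'I_(mdeg m).+1, (f ^+ r) u' m != 0.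
  apply: contrapT => /forallNP H; move: n; rewrite /hser_exp /exp_trunc coef_sum big1 ?eqxx //.
  by move=> r _; have /negP/negPn/eqP := H r; rewrite coef_cst => ->; rewrite mulr0.
exists r; first by have := ltn_ord r; rewrite /=; lia.
by split=> //; exists u'.
Qed.

Lemma hser_log_neq0 f u m : hser_log f u m != 0 ->
  exists2 r, (r < mdeg m)%N & ((f - 1) ^+ r.+1) u m != 0.
Proof.
move=> n; apply: contrapT => H; move: n; rewrite /hser_log /log_trunc coef_sum big1 ?eqxx //.
move=> r _; apply/eqP/negPn/negP; rewrite coef_cst mulf_eq0 negb_or => /andP[_ n].
by apply: H; exists r.
Qed.

Lemma hser_fin_log f : hser_fin f -> hser_fin (hser_log f).
Proof.
move=> ff; have fv : hser_fin (f - 1).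
  move=> D u; have fin : finite_set
     ([set m : mono | (mdeg m <= D)%N /\ exists2 u', (u' <= u)%N & f u' m != 0] `|`
      [set m : mono | (mdeg m <= D)%N /\ exists2 u', (u' <= u)%N & (1 : A) u' m != 0]).
    by rewrite finite_setU; split; [exact: ff|exact: hser_fin1].
  apply: sub_finite_set fin => m [mD [u' uu']].
  rewrite coefD coefN => /addr_neq0 []; last rewrite oppr_eq0; move=> n.
    by left; split=> //; exists u'.
  by right; split=> //; exists u'.
move=> D u; have fin : finite_set (\bigcup_(r in `I_D)
   [set m : mono | (mdeg m <= D)%N /\ exists2 u', (u' <= u)%N & ((f - 1) ^+ r.+1) u' m != 0]).
  by apply: bigcup_finite => [|r _]; [exact: finite_II|exact: hser_finX].
apply: sub_finite_set fin => m /= [mD [u' uu' /hser_log_neq0 [r rm n]]].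
exists r; first by rewrite /=; lia.
by split=> //; exists u'.
Qed.

End PowerSeries.

(** * Translation between series in hbar and x and power series in hbar and y *)

Section Embedding.
Variables (R : realType) (I : countType).
Local Notation C := (R[i]).
Local Notation mono := (multiset I).
Local Notation A := (hser R I).
Implicit Types (m al be : mono) (f g : A).

(** The substitution y = x / hbar: hbar^u y^m is hbar^(u - |m|) x^m, hence the exponent u = q +
    |m|. *)
Definition emb f : ser R I := fun q m =>
  if q + (mdeg m)%:Z is Posz u then f u m else 0.

Definition res (f : ser R I) : A := fun u m => f (u%:Z - (mdeg m)%:Z) m.

Lemma embE f u m q : q + (mdeg m)%:Z = u%:Z -> emb f q m = f u m.
Proof. by rewrite /emb => ->. Qed.

Lemma emb_neq0 f q m : emb f q m != 0 ->
  exists2 u : nat, q + (mdeg m)%:Z = u%:Z & f u m != 0.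
Proof. by rewrite /emb; case E: (q + _) => [u|u]; [exists u|rewrite eqxx]. Qed.

Lemma embK f : res (emb f) = f.
Proof. by apply: hserP => u m; rewrite /res (@embE _ u) // subrK. Qed.

Lemma emb_inj f g : emb f = emb g -> f = g.
Proof. by move=> E; rewrite -[f]embK E embK. Qed.

Lemma resK (f : ser R I) : ser_vis f -> emb (res f) = f.
Proof.
move=> fv; apply/funext => q; apply/funext => m; rewrite /emb /res.
case E: (q + _) => [u|u]; first by rewrite -E addrK.
by apply/esym/eqP/negPn/negP => /fv; rewrite E.
Qed.

Lemma emb_fin f : hser_fin f -> ser_fin (emb f).
Proof.
move=> ff D q; apply: sub_finite_set (ff D (`|q| + D)%N) => m [mD [q' qq' /emb_neq0 [u uE n]]].
by split=> //; exists u => //; lia.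
Qed.

Lemma res_fin (f : ser R I) : ser_fin f -> hser_fin (res f).
Proof.
move=> ff D u; apply: sub_finite_set (ff D u%:Z) => m [mD [u' uu' n]].
by split=> //; eexists; last exact: n; lia.
Qed.

Lemma emb0 : emb 0 = @ser0 R I.
Proof. by apply/funext => q; apply/funext => m; rewrite /emb; case: (q + _). Qed.

Lemma embN f : emb (- f) = ser_opp (emb f).
Proof.
apply/funext => q; apply/funext => m; rewrite /emb /ser_opp.
by case: (q + _) => u; rewrite ?oppr0.
Qed.

Lemma emb1 : emb 1 = @ser_one R I.
Proof.
apply/funext => q; apply/funext => m; rewrite /emb /ser_one.
case: (eqVneq m (mzero I)) => [->|m0]; last first.
  by rewrite andbF; case: (q + _) => // u; rewrite coef1 (negbTE m0) andbF.
by rewrite mdeg0 addr0 andbT; case: q => [[|u]|u] //; rewrite coef1 ?eqxx /= ?eqxx.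
Qed.

Lemma emb_mul f g : ser_mul (emb f) (emb g) = emb (f * g).
Proof.
apply/funext => q; apply/funext => m; rewrite [RHS]/emb /ser_mul.
have neq (t : int * int * mono * mono) :
   (let: (q1, q2, m1, m2) := t in q1 + q2 = q /\ m1 :+: m2 = m) ->
   (let: (q1, q2, m1, m2) := t in emb f q1 m1 * emb g q2 m2) != 0 ->
   let: (q1, q2, m1, m2) := t in exists u1 u2 : nat,
   [/\ q1 + (mdeg m1)%:Z = u1%:Z, q2 + (mdeg m2)%:Z = u2%:Z &
     q + (mdeg m)%:Z = (u1 + u2)%N%:Z].
  case: t => [[[q1 q2] m1] m2] [<- <-]; rewrite mulf_eq0 negb_or => /andP[].
  move=> /emb_neq0 [u1 E1 _] /emb_neq0 [u2 E2 _]; exists u1, u2; split=> //.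
  by rewrite mdegD; lia.
case E: (q + (mdeg m)%:Z) => [u|u]; last first.
  apply: fsbig1 => -[[[q1 q2] m1] m2] /= d; apply/eqP/negPn/negP.
  by move=> /(neq (q1, q2, m1, m2) d) [u1 [u2 [_ _]]]; rewrite E.
rewrite coefM; apply: (@fsum_bij _ (int * int * mono * mono)%type
  ((nat * mono) * (nat * mono))%type
  _ _ _ _ (fun t : int * int * mono * mono => let: (q1, q2, m1, m2) := t in
    ((absz (q1 + (mdeg m1)%:Z), m1), (absz (q2 + (mdeg m2)%:Z), m2)))
  (fun x : (nat * mono) * (nat * mono) =>
    (x.1.1%:Z - (mdeg x.1.2)%:Z, x.2.1%:Z - (mdeg x.2.2)%:Z, x.1.2, x.2.2))).
- move=> [[[q1 q2] m1] m2] d n; have [u1 [u2 [E1 E2]]] := neq (q1, q2, m1, m2) d n.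
  rewrite E => -[E3]; have [d1 d2] := d; rewrite E1 E2 /=; split.
  + by rewrite /dec /kadd /= d2 E3.
  + by rewrite -E1 -E2 !addrK.
  + by rewrite /coefk (embE _ E1) (embE _ E2).
- move=> [[u1 m1] [u2 m2]]; rewrite /dec /kadd /coefk /= => -[E1 E2] _; split.
  + split=> //; move: E; rewrite -E2 mdegD -E1; lia.
  + by rewrite !subrK.
  + by rewrite (@embE _ u1) ?subrK // (@embE _ u2) ?subrK.
Qed.

Lemma emb_pow f r : ser_pow (emb f) r = emb (f ^+ r).
Proof. by elim: r => [|r IH] /=; rewrite ?expr0 ?emb1 // exprS -emb_mul IH. Qed.

(** The sum over all r is finite in each coefficient because f^r has no terms of degree below r. *)
Lemma emb_exp f : low 1 f -> ser_exp (emb f) = emb (hser_exp f).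
Proof.
move=> f1; apply/funext => q; apply/funext => m; rewrite /ser_exp.
rewrite (fsum_seq (s := iota 0 (mdeg m).+1)); first last.
- move=> r _; rewrite mulf_eq0 negb_or emb_pow => /andP[_ /emb_neq0 [u _ n]].
  rewrite mem_iota /= add0n leqNgt; apply: contra n => mr.
  by rewrite (lowX f1).
- exact: iota_uniq.
rewrite /emb /hser_exp; case E: (q + _) => [u|u]; last first.
  by apply: big1 => r _; rewrite emb_pow /emb E mulr0.
rewrite /exp_trunc coef_sum -(big_mkord xpredT
   (fun r => (hser_cst (r`!%:R^-1) * f ^+ r) u m)) /index_iota subn0.
rewrite big_mkcond; apply: eq_bigr => r _.
have rT : r \in [set: nat] by exact: mem_set.
by rewrite rT emb_pow coef_cst /emb E.
Qed.

(** This is hbar d/dx^i = d/dy^i. *)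
Lemma emb_der i f q m :
  (m i).+1%:R * emb f (q - 1) (m :+: mone i) = emb (der i f) q m.
Proof.
rewrite /emb mdegD mdeg_mone (_ : q - 1 + _ = q + (mdeg m)%:Z); last lia.
by case: (q + _) => // u; rewrite mulr0.
Qed.

End Embedding.

(** * The logarithm of the wave function has at most a simple pole in hbar *)

Section FreeEnergy.
Variables (R : realType) (I : countType).
Local Notation C := (R[i]).
Local Notation mono := (multiset I).
Local Notation A := (hser R I).
Implicit Types (m al be : mono) (f g : A).

(* hbar^p x^al, written in the variables hbar and y = x / hbar. *)
Definition xmon (p : nat) al : A := fun u m =>
  if (u == (p + mdeg al)%N) && (m == al) then 1 else 0.

Lemma coef_xmon p al g u m : (xmon p al * g) u m =
  if (p + mdeg al <= u)%N && msubset al m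
  then g (u - (p + mdeg al))%N (m :-: al) else 0.
Proof.
rewrite coefM; have nz x : dec (u, m) x -> coefk (xmon p al) x.1 * coefk g x.2 != 0 ->
    x.1 = ((p + mdeg al)%N, al).
  case: x => [[u1 m1] x2] _; rewrite mulf_eq0 negb_or => /andP[/if_neq0 [] /andP[]].
  by move=> /eqP /= -> /eqP ->.
case: ifP => [/andP[le s]|H].
  rewrite (fsum1 (t0 := (((p + mdeg al)%N, al), ((u - (p + mdeg al))%N, m :-: al)))).
  - by rewrite /coefk /xmon /= !eqxx mul1r.
  - rewrite /dec /kadd /= subnKC //; congr pair; mset_lia.
  - move=> [x1 [u2 m2]] d /(nz _ d) /= E; move: d; rewrite E /dec /kadd /= => -[<- <-].
    by congr (_, (_, _)); [lia|mset_lia].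
apply: fsbig1 => -[x1 [u2 m2]] d; apply/eqP/negPn/negP => /(nz _ d) /= E.
move: d; rewrite E /dec /kadd /= => -[Eu Em]; move/negP: H; apply.
rewrite -Eu -Em leq_addr; mset_lia.
Qed.

(** The operator (hbar d)^be, that is, the iterated derivative with respect to y. *)
Definition derp be f : A := fun u m => mffact R (m :+: be) be * f u (m :+: be).

Lemma derp0 f : derp (mzero I) f = f.
Proof. by apply: hserP => u m; rewrite /derp mffact0 mul1r /mzero msetD0. Qed.

Lemma derpD be k f : derp (be :+: mone k) f = der k (derp be f).
Proof.
apply: hserP => u m; rewrite /derp /der mffactD mffact_mone.
rewrite (_ : m :+: mone k :+: be = m :+: (be :+: mone k)); last by mset_lia.
rewrite (_ : (m :+: (be :+: mone k) :-: be) k = (m k).+1); first by ring.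
by rewrite msetBE !msetDE msetnE eqxx; lia.
Qed.

Lemma act_term_emb P f q m p al be m' :
  al :+: m' = m :+: be -> msubset be m' ->
  act_term P (emb f) q (p, al, be, m') =
  P p al be * emb (xmon p al * derp be f) q m.
Proof.
move=> d s; rewrite /act_term -mulrA; congr (_ * _).
have dg := act_dom_deg d; have sa : msubset al m by mset_lia.
have mE : m :-: al :+: be = m' by mset_lia.
case E: (q - p%:Z - (mdeg be)%:Z + (mdeg m')%:Z) => [u|u].
  rewrite (embE _ E) (@embE _ _ _ (u + (p + mdeg al))%N); last lia.
  by rewrite coef_xmon leq_addl sa /= addnK /derp mE.
rewrite {1}/emb E mulr0 /emb; case E': (q + _) => [v|v] //.
by rewrite coef_xmon ifF //; apply/negP => /andP[]; lia.
Qed.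

Lemma weyl_act_emb P f q m : weyl_act P (emb f) q m =
  \sum_(x \in [set: nat * mono * mono])
    P x.1.1 x.1.2 x.2 * emb (xmon x.1.1 x.1.2 * derp x.2 f) q m.
Proof.
rewrite weyl_actE; apply: (@fsum_bij _ (nat * mono * mono * mono)%type
  (nat * mono * mono)%type _ _ _ _ (fun t => t.1)
  (fun x => (x.1.1, x.1.2, x.2, m :+: x.2 :-: x.1.2))).
- move=> [[[p al] be] m'] d n; have [_ /mffact_neq0 s _] := mulf3_neq0 n.
  rewrite /act_dom /= in d; split=> //.
    by congr (_, _, _, _); clear -d; mset_lia.
  by rewrite (act_term_emb _ _ _ _ d s).
- move=> [[p al] be] _ /=; rewrite mulf_eq0 negb_or => /andP[_ /emb_neq0 [u _]].
  rewrite coef_xmon => /if_neq0 [/andP[_ s] _].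
  have d : al :+: (m :+: be :-: al) = m :+: be by mset_lia.
  split=> //.
  by rewrite -(act_term_emb _ _ _ _ d) //; mset_lia.
Qed.

(** A local form of [unipotent_mul_eq0]: the coefficient of (w - 1) f at (u, m) involves f only in
    smaller degree and at exponents of hbar at most u, hence inside the box. *)
Lemma unipotent_box w f D U : low 1 (w - 1) ->
  (forall u m, (mdeg m <= D)%N -> (u <= U)%N -> (w * f) u m = 0) ->
  forall u m, (mdeg m <= D)%N -> (u <= U)%N -> f u m = 0.
Proof.
move=> w1 wf u m; move: {2}(mdeg m) (leqnn (mdeg m)) => n; elim: n u m => [|n IH] u m mn mD uU.
  have -> : f = w * f - (w - 1) * f by ring.
  by rewrite coefD coefN wf // (lowMl _ w1) ?subr0 // ltnS.
have -> : f = w * f - (w - 1) * f by ring.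
rewrite coefD coefN wf // sub0r; apply/eqP; rewrite oppr_eq0.
apply/negPn/negP => /coefM_neq0 [u1 [m1 [u2 [m2 [uE mE n1 /negP n2]]]]].
have d1 : (0 < mdeg m1)%N by rewrite lt0n; apply: contra n1 => /eqP E; rewrite w1 ?E.
apply: n2; apply/eqP; apply: IH; move: mn mD uU; rewrite mE uE mdegD; lia.
Qed.

Variable Q : I -> weyl R I.
Hypotheses (Qw : Qweight2 Q) (Qf : family_colfin Q).

Section Recursion.
Variables (psiA F : A).
Hypotheses (psi1 : low 1 (psiA - 1)) (psiF : forall i, der i psiA = psiA * der i F).
Hypothesis psif : hser_fin psiA.
Hypothesis Hpsi : forall i q m, weyl_act (Hadd Q i) (emb psiA) q m = 0.
Hypothesis Fw : forall u m, F u m != 0 -> (mdeg m + 1 <= u.*2)%N.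

(** T_be is psi^-1 d^be psi, the Bell polynomial in the derivatives of F, generated by T_(be + e_k)
    = d_k F T_be + d_k T_be. *)
Lemma conj_derp : exists T : mono -> A, forall be, derp be psiA = psiA * T be.
Proof.
suff /choice [T TE] : forall be, exists t : A, derp be psiA = psiA * t by exists T.
elim/mono_ind => [|k be [t E]]; first by exists 1; rewrite derp0 mulr1.
exists (der k F * t + der k t); rewrite derpD E derM psiF; ring.
Qed.

(* The equation psi^-1 H_i psi = 0 read off as a recursion for d_i F; only its
   support matters for the order of the pole in hbar. *)
Lemma der_F_neq0 (T : mono -> A) i u0 m0 : (forall be, derp be psiA = psiA * T be) ->
  der i F u0 m0 != 0 ->
  exists p al be, Q i p al be != 0 /\ (xmon p al * T be) u0 m0 != 0.
Proof.
move=> TE n.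
(* [Q i] may have infinitely many terms, but only finitely many can meet psi in the box |m| <= |m0|,
   u <= u0. The margin 2 in the degree is the order of [Q i]. *)
have fin : finite_set [set x : nat * mono * mono | Q i x.1.1 x.1.2 x.2 != 0 /\
   exists m', [/\ (mdeg m' <= mdeg m0 + 2)%N /\
     exists2 u', (u' <= u0)%N & psiA u' m' != 0 & msubset x.2 m']].
  have fin1 := finite_sigma (B := fun m' : mono => [set be | msubset be m'])
     (psif (mdeg m0 + 2)%N u0) (fun m' _ => finite_submono m').
  have fin2 := finite_sigma (B := fun x : mono * mono =>
     [set y : nat * mono | Q i y.1 y.2 x.2 != 0]) fin1
     (fun x _ => @Q_colfin _ _ _ Qf i x.2).
  apply: sub_finite_set (finite_image (fun x : (mono * mono) * (nat * mono) =>
     (x.2.1, x.2.2, x.1.2)) fin2).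
  by move=> [[p al] be] /= [Qn [m' [H1 H2]]]; exists ((m', be), (p, al)).
have [s us sP] := finite_enum fin.
pose Y := der i F - \sum_(x <- s) hser_cst (Q i x.1.1 x.1.2 x.2) * (xmon x.1.1 x.1.2 * T x.2).
have Y0 : Y u0 m0 = 0.
  (* The sum over [s] represents the full equation only inside this box, so psi can be cancelled
     only there. *)
  apply: (@unipotent_box psiA Y (mdeg m0) u0 psi1) => // u m mD uU.
  have -> : psiA * Y = der i psiA - \sum_(x <- s)
     hser_cst (Q i x.1.1 x.1.2 x.2) * (xmon x.1.1 x.1.2 * derp x.2 psiA).
    rewrite /Y mulrBr psiF; congr (_ - _); rewrite mulr_sumr; apply: eq_bigr => x _.
    by rewrite TE; ring.
  rewrite coefD coefN coef_sum; pose q := u%:Z - (mdeg m)%:Z.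
  have qE : q + (mdeg m)%:Z = u%:Z by rewrite subrK.
  have := Hpsi i q m; rewrite weyl_act_Hadd //; last exact: emb_fin.
  rewrite emb_der (embE _ qE) weyl_act_emb (fsum_seq us); last first.
    move=> [[p al] be] _ /=; rewrite mulf_eq0 negb_or (embE _ qE) coef_xmon => /andP[Qn].
    move=> /if_neq0 [/andP[_ sa]]; rewrite /derp mulf_eq0 negb_or => /andP[/mffact_neq0 sb pn].
    apply: sP; split=> //; exists (m :-: al :+: be); split=> //; split.
      by have := Qw Qn; rewrite mdegD mdegB //; lia.
    by eexists; last exact: pn; lia.
  move=> /eqP; rewrite subr_eq0 => /eqP <-; apply/eqP; rewrite subr_eq0; apply/eqP.
  rewrite big_mkcond; apply: eq_bigr => x _.
  have xT : x \in [set: nat * mono * mono] by exact: mem_set.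
  by rewrite xT coef_cst (embE _ qE).
move: Y0; rewrite /Y coefD coefN coef_sum => /eqP; rewrite subr_eq0 => /eqP E.
apply: contrapT => H; move: n; rewrite E big1 ?eqxx // => -[[p al] be] _ /=.
rewrite coef_cst; apply/eqP/negPn/negP; rewrite mulf_eq0 negb_or => /andP[n1 n2].
by apply: H; exists p, al, be.
Qed.

Lemma der_neq0 k f u m : der k f u m != 0 -> f u (m :+: mone k) != 0.
Proof. by rewrite /der mulf_eq0 negb_or => /andP[_]. Qed.

(** Induction on the weight 2u - |m|. A y-derivative is hbar times an x-derivative, so d_k F is
    regular in hbar wherever F has at most a simple pole; regular series multiply, and x^al is
    regular. Since |be| <= 2, the recursion for d_i F involves only 1, d_k F, d_k F d_j F and d_k
    d_j F. *)
Lemma F_pole u m : F u m != 0 -> (mdeg m <= u + 1)%N.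
Proof.
have [T TE] := conj_derp.
have TU be t : derp be psiA = psiA * t -> T be = t.
  rewrite TE => E; apply/eqP; rewrite -subr_eq0; apply/eqP.
  by apply: (unipotent_mul_eq0 psi1); rewrite mulrBr E subrr.
suff H n : F u m != 0 -> (u.*2 <= mdeg m + n)%N -> (mdeg m <= u + 1)%N.
  by move=> Fn; apply: (H u.*2) => //; rewrite leq_addl.
elim/ltn_ind: n u m => n IH u m Fn wn.
case: (mono_split m) => [->|[i [m1 mE]]]; first by rewrite mdeg0.
have : der i F u m1 != 0 by rewrite /der mulf_neq0 // -?mE // pnatr_eq0.
move=> /(der_F_neq0 TE) [p [al [be [/Qw w]]]]; rewrite coef_xmon => /if_neq0 [/andP[pu s]].
have := mdegB s; have := msub_deg s; set m' := m1 :-: al; set u' := (u - _)%N.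
move=> sd m'E Tn; have uE : u = (u' + (p + mdeg al))%N by rewrite /u'; lia.
have mD : mdeg m = (mdeg m' + mdeg al + 1)%N by rewrite mE mdegD mdeg_mone; lia.
have Fw0 := Fw Fn.
(* The factor x^al shifts u and |m| equally; what remains is that hbar^p T_be has no pole at this
   coefficient. *)
suff : (mdeg m' <= u' + p)%N by rewrite mD; lia.
(* The second premise says that the component of F at m1' + e_k has smaller weight than the one at
   m; the conclusion is that d_k F has no pole there. *)
have IH' u1 m1' k : F u1 (m1' :+: mone k) != 0 ->
    (u1.*2 + mdeg m < u.*2 + mdeg m1' + 1)%N -> (mdeg m1' <= u1)%N.
  move=> Fn' lt; have := Fw Fn'; have := IH (u1.*2 - (mdeg m1' + 1))%N _ u1 (m1' :+: mone k).
  by rewrite mdegD mdeg_mone => H1 H2; have := H1 _ Fn' _; lia.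
case: (mono_split be) => [beE|[k [be1 beE]]].
  move: Tn; rewrite beE (TU _ 1) ?derp0 ?mulr1 // coef1 => /if_neq0 [/andP[_ /eqP ->] _].
  by rewrite mdeg0.
have T1 j : T (mone j) = der j F.
  by apply: TU; rewrite -[mone j]mset0D derpD derp0 psiF.
case: (mono_split be1) => [be1E|[j [be2 be1E]]].
  rewrite beE be1E /mzero mset0D mdeg_mone T1 in Tn w.
  by have := IH' _ _ _ (der_neq0 Tn); lia.
have be20 : be2 = mzero I.
  by apply: mdeg_eq0; move: w; rewrite beE be1E !mdegD !mdeg_mone; lia.
rewrite beE be1E be20 /mzero mset0D mdegD !mdeg_mone in Tn w.
rewrite (TU _ (der k F * der j F + der k (der j F))) in Tn; last first.
  by rewrite derpD TE T1 derM psiF; ring.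
move: Tn; rewrite coefD => /addr_neq0 [].
  move=> /coefM_neq0 [u1 [m1' [u2 [m2' [uE' mE' /der_neq0 n1 /der_neq0 n2]]]]].
  (* The weights of the two components of F add up to one less than that of [F u m], and each is at
     least 1 by [Fw], so the induction applies to both. *)
  have := Fw n1; have := Fw n2; rewrite !mdegD !mdeg_mone => w2 w1.
  have := congr1 (@mdeg I) mE'; rewrite mdegD => mE2.
  by have := IH' _ _ _ n1; have := IH' _ _ _ n2; lia.
move=> /der_neq0 /der_neq0 n1; have := IH' _ _ _ n1; rewrite mdegD mdeg_mone; lia.
Qed.

End Recursion.
End FreeEnergy.

(** * Existence of the free energy *)

Section Existence.
Variables (R : realType) (I : countType) (Q : I -> weyl R I).
Local Notation mono := (multiset I).
Local Notation A := (hser R I).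
Hypotheses (Qw : Qweight2 Q) (Qf : family_colfin Q).
Hypothesis Hcomm : forall i j, exists g : I -> R[i],
  weyl_comm (Hadd Q i) (Hadd Q j) = weyl_hbar (weyl_lincomb g (Hadd Q)).

Let psiA : A := res (psi Q).
Let F : A := hser_log psiA.

Let psiAE : emb psiA = psi Q.
Proof. by apply: resK; exact: psi_tot_vis. Qed.

Let psi1 : low 1 (psiA - 1).
Proof.
move=> u m; rewrite ltnS leqn0 => /eqP/mdeg_eq0 ->.
rewrite coefD coefN coef1 eqxx andbT /psiA /res mdeg0 subr0 psi_mzero /ser_one.
by rewrite eqxx andbT subrr.
Qed.

Let psif : hser_fin psiA.
Proof. by apply: res_fin; exact: psi_fin. Qed.

(** The weight of the coefficient is 2u - |m|, and the weight 0 part of psi is 1. *)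
Let vw u m : (psiA - 1) u m != 0 -> (mdeg m + 1 <= u.*2)%N.
Proof.
rewrite coefD coefN => n; rewrite leqNgt; apply/negP => lt; move/negP: n; apply.
have wE : wt (u%:Z - (mdeg m)%:Z) m = u.*2%:Z - (mdeg m)%:Z by rewrite /wt; lia.
rewrite subr_eq0 coef1 /psiA /res.
case: (eqVneq u.*2 (mdeg m)) => [E|ne].
  rewrite psi_wt0; last by rewrite wE; lia.
  rewrite /ser_one; case: (eqVneq m (mzero I)) => [->|_]; last by rewrite !andbF.
  by rewrite mdeg0 subr0 !andbT.
have -> : psi Q (u%:Z - (mdeg m)%:Z) m = 0.
  by apply/eqP/negPn/negP => /psi_wt_ge0; rewrite wE; lia.
case: ifP => [/andP[/eqP u0 /eqP m0]|]; last by rewrite eqxx.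
by move: ne; rewrite u0 m0 mdeg0.
Qed.

(** Weights add up in products, and every term of the logarithm contains at least one factor psi -
    1. *)
Let Fw u m : F u m != 0 -> (mdeg m + 1 <= u.*2)%N.
Proof.
move=> /hser_log_neq0 [r _]; elim: r u m => [|r IH] u m; first by rewrite expr1; exact: vw.
rewrite exprS => /coefM_neq0 [u1 [m1 [u2 [m2 [-> -> /vw w1 /IH w2]]]]].
by rewrite mdegD; lia.
Qed.

Let Fpole u m : F u m != 0 -> (mdeg m <= u + 1)%N.
Proof.
apply: (F_pole Qw Qf psi1 _ psif _ Fw).
- by move=> i; exact: der_log.
- by move=> i q m'; rewrite psiAE; exact: psi_ker.
Qed.

Lemma exists_free_energy : exists F : A,
  [/\ low 1 F, hser_fin F, forall u m, F u m != 0 -> (mdeg m + 1 <= u.*2)%N,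
      forall u m, F u m != 0 -> (mdeg m <= u + 1)%N &
      forall i q m, weyl_act (Hadd Q i) (emb (hser_exp F)) q m = 0].
Proof.
exists F; split=> //; first exact: low_log.
  exact: hser_fin_log.
by move=> i q m; rewrite hser_logK // psiAE; exact: psi_ker.
Qed.

End Existence.

(** * From the series F to the polynomials S_{h,n} and back *)

Section Coefficients.
Variables (R : realType) (I : countType).
Local Notation mono := (multiset I).
Local Notation A := (hser R I).
Implicit Types (S : nat -> nat -> poly_mono R I) (F : A).

Definition poly_of F (h n : nat) : poly_mono R I := fun m =>
  if mdeg m == n then emb F (h%:Z - 1) m else 0.

Lemma poly_of_homog F h n : hser_fin F -> homog_poly n (poly_of F h n).
Proof.
move=> ff; split=> [|m]; last by move=> /if_neq0 [/eqP].
apply: sub_finite_set (ff n (h + n)%N) => m /= /if_neq0 [/eqP mn /emb_neq0 [u uE n0]].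
by split; [rewrite mn|exists u => //; lia].
Qed.

(** [free_energy] has no room for powers of hbar below -1 or for degree 0: the pole bound excludes
    the former, [low 1] the latter. *)
Lemma free_energy_poly_of F : low 1 F ->
  (forall u m, F u m != 0 -> (mdeg m <= u + 1)%N) -> free_energy (poly_of F) = emb F.
Proof.
move=> F1 Fp; apply/funext => q; apply/funext => m; rewrite /free_energy.
case E: (q + 1) => [h|h]; last first.
  by apply/esym/eqP/negPn/negP => /emb_neq0 [u uE /Fp]; lia.
have -> : q = h%:Z - 1 by lia.
case: (posnP (mdeg m)) => m0.
  rewrite fsbig1; last by move=> n /= n0; rewrite /poly_of m0; case: n n0.
  apply/esym/eqP/negPn/negP => /emb_neq0 [u _].
  by rewrite F1 ?eqxx // m0.
rewrite (fsum1 (t0 := mdeg m)) //; first by rewrite /poly_of eqxx.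
by move=> n _ /if_neq0 [/eqP].
Qed.

Lemma free_energyE S h m : (forall h n, (0 < n)%N -> homog_poly n (S h n)) ->
  (0 < mdeg m)%N -> free_energy S (h%:Z - 1) m = S h (mdeg m) m.
Proof.
move=> Sh m0; rewrite /free_energy subrK (fsum1 (t0 := mdeg m)) //.
by move=> n n0; have [_ H] := Sh h n n0; move=> /H.
Qed.

Lemma free_energy_neq0 S q m : (forall h n, (0 < n)%N -> homog_poly n (S h n)) ->
  free_energy S q m != 0 ->
  exists h : nat, [/\ q = h%:Z - 1, (0 < mdeg m)%N & S h (mdeg m) m != 0].
Proof.
move=> Sh; rewrite /free_energy; case E: (q + 1) => [h|h]; last by rewrite eqxx.
move=> /fsum_neq0 [n n0 nz]; have [_ H] := Sh h n n0; have mE := H m nz.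
by exists h; rewrite mE; split=> //; lia.
Qed.

(** Brings an arbitrary solution into the setting of [ker_uniq]: a wave function with finiteness,
    nonnegative weights, and annihilated by all H_i. *)
Lemma airy_solution_series (a b c : I -> I -> I -> R[i]) eps S :
  quantum_airy a b c eps -> airy_solution a b c eps S ->
  exists F : A, [/\ free_energy S = emb F, low 1 F, hser_fin (hser_exp F),
    forall u m, hser_exp F u m != 0 -> (mdeg m <= u.*2)%N &
    forall i q m, weyl_act (Hadd (Qop a b c eps) i) (emb (hser_exp F)) q m = 0].
Proof.
move=> [pre _] [Sh S1 S2 sol]; pose F : A := res (free_energy S).
have FE : emb F = free_energy S.
  by apply: resK => q m /(free_energy_neq0 Sh) [h [-> m0 _]]; lia.
have F1 : low 1 F.
  move=> u m; rewrite ltnS leqn0 => m0; apply/eqP/negPn/negP.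
  by move=> /(free_energy_neq0 Sh) [h [_]]; move: m0; case: (mdeg m).
have Ff : hser_fin F.
  apply: res_fin => D q; pose N := (absz (q + 1)).+1.
  have fin : finite_set (\bigcup_(hn in `I_N `*` (`I_D.+1 `&` [set n | (0 < n)%N]))
      [set m | S hn.1 hn.2 m != 0]).
    apply: bigcup_finite; last by move=> [h n] [_ [_ n0]]; have [] := Sh h n n0.
    by apply: finite_setX; [exact: finite_II|apply: finite_setIl; exact: finite_II].
  apply: sub_finite_set fin => m [mD [q' qq' /(free_energy_neq0 Sh) [h [qE m0 n]]]].
  by exists (h, mdeg m) => //; split=> /=; [rewrite /N; lia|split].
(* For h > 0 the weight 2h - 2 + n is positive; for h = 0 the vanishing of S_{0,1} and S_{0,2}
   leaves n >= 3. *)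
have Fw u m : F u m != 0 -> (mdeg m <= u.*2)%N.
  move=> /(free_energy_neq0 Sh) [[|h] [E m0]]; last by lia.
  case: (mdeg m) m0 E => [|[|[|n]]] // _ E; last by lia.
    by rewrite S1 eqxx.
  by rewrite S2 eqxx.
exists F; split=> //.
- exact: hser_fin_exp.
- move=> u m n; have [r] : exists r : nat, (F ^+ r) u m != 0.
    apply: contrapT => /forallNP H; move: n; rewrite /hser_exp /exp_trunc coef_sum.
    rewrite big1 ?eqxx // => r _; rewrite coef_cst.
    by have /negP/negPn/eqP -> := H r; rewrite mulr0.
  elim: r u m {n} => [|r IH] u m.
    by rewrite expr0 coef1 => /if_neq0 [/andP[_ /eqP ->] _]; rewrite mdeg0.
  rewrite exprS => /coefM_neq0 [u1 [m1 [u2 [m2 [-> -> /Fw w1 /IH w2]]]]].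
  by rewrite mdegD; lia.
- move=> i; have := sol i; rewrite Hop_split /wave /wave_inv -FE emb_exp // -embN.
  rewrite emb_exp; last exact: lowN.
  set X := weyl_act _ _; have Xv : ser_vis X.
    by apply: weyl_act_vis => q m /emb_neq0 [u -> _].
  (* The factor exp(-F) is 1 at y = 0, so it can be cancelled from the product. *)
  rewrite -(resK Xv) emb_mul -emb0 => /emb_inj /unipotent_mul_eq0 -> //; last first.
    exact: hser_exp_unipotent.
  by move=> q m; rewrite emb0.
Qed.

End Coefficients.

Theorem theorem2p30 (R : realType) (I : countType)
    (a b c : I -> I -> I -> R[i]) (eps : I -> R[i]) :
  quantum_airy a b c eps ->
  (exists S : nat -> nat -> poly_mono R I, airy_solution a b c eps S) /\
  (forall S S' : nat -> nat -> poly_mono R I,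
      airy_solution a b c eps S -> airy_solution a b c eps S' ->
      forall h n, (0 < n)%N -> S h n = S' h n).
Proof.
move=> qa; have [pre [g gE]] := qa.
have Qw := @Qop_weight2 R I a b c eps; have Qf := Qop_family_colfin pre.
split.
  have Hcomm i j : exists g : I -> R[i], weyl_comm (Hadd (Qop a b c eps) i)
      (Hadd (Qop a b c eps) j) = weyl_hbar (weyl_lincomb g (Hadd (Qop a b c eps))).
    by exists (g i j); rewrite -Hop_split.
  have [F [F1 Ff Fw Fp FH]] := exists_free_energy Qw Qf Hcomm.
  exists (poly_of F); split.
  - by move=> h n _; exact: poly_of_homog.
  (* With h = 0 the exponent is u = |m| - 1, and |m| + 1 <= 2u fails for |m| = 1 and, in the next
     case, for |m| = 2. *)
  - apply/funext => m; apply/eqP/negPn/negP => /if_neq0 [/eqP m1 /emb_neq0 [u uE /Fw]].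
    by lia.
  - apply/funext => m; apply/eqP/negPn/negP => /if_neq0 [/eqP m1 /emb_neq0 [u uE /Fw]].
    by lia.
  - move=> i; rewrite /wave free_energy_poly_of // emb_exp // Hop_split.
    have -> : weyl_act (Hadd (Qop a b c eps) i) (emb (hser_exp F)) = @ser0 R I.
      by apply/funext => q; apply/funext => m; rewrite FH.
    apply/funext => q; apply/funext => m; apply: fsbig1 => -[[[q1 q2] m1] m2] _.
    by rewrite mulr0.
move=> S S' sS sS' h n n0.
have [F [FE F1 Ff Fw FH]] := airy_solution_series qa sS.
have [F' [FE' F1' Ff' Fw' FH']] := airy_solution_series qa sS'.
have vw (G : hser R I) : (forall u m, G u m != 0 -> (mdeg m <= u.*2)%N) ->
    forall q m, emb G q m != 0 -> 0 <= wt q m.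
  by move=> Gw q m /emb_neq0 [u uE /Gw]; rewrite /wt; lia.
have expE : hser_exp F = hser_exp F'.
  apply: emb_inj; apply: (ker_uniq Qw Qf (emb_fin Ff) (emb_fin Ff') (vw _ Fw) (vw _ Fw')) => //.
  (* At y = 0 both exponentials equal 1, for every power of hbar. *)
  move=> q; rewrite /emb; case: (q + _) => // u.
  have e1 (G : hser R I) : hser_exp G u (mzero I) = (1 : hser R I) u (mzero I).
    have := @hser_exp_unipotent R I G u (mzero I); rewrite mdeg0 => /(_ isT) /eqP.
    by rewrite coefD coefN subr_eq0 => /eqP.
  by rewrite !e1.
(* The identity exp F d_i F = d_i (exp F) determines d_i F, since exp F can be cancelled; both
   series vanish at y = 0. *)
have FF' : F = F'.
  apply: der_inj => // i; apply/eqP; rewrite -subr_eq0; apply/eqP.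
  apply: (unipotent_mul_eq0 (@hser_exp_unipotent R I F)).
  by rewrite mulrBr -der_exp // {2}expE -der_exp // expE subrr.
have [Sh _ _ _] := sS; have [Sh' _ _ _] := sS'.
apply/funext => m; case: (eqVneq (mdeg m) n) => [mE|mn].
  by rewrite -mE -!free_energyE ?mE // FE FE' FF'.
have z (P : poly_mono R I) : homog_poly n P -> P m = 0.
  by move=> [_ H]; apply/eqP; apply: contraNT mn => /H ->.
by rewrite !z //; [exact: Sh'|exact: Sh].
Qed.
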